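(* Let $\delta>0$ be fixed and let $H$ be a fixed connected graph having no vertices of degree one and maximal degree $\Delta\ge 2$. Let $d=d_n$ be such that $p=p(n):=d/n$ satisfies $n^{-1/\Delta}\ll p=o(1)$ as $n\to\infty$. Then $$\lim_{n\to\infty}\phi_n^d(H,1+\delta)=c^d(H,\delta):=\frac12\begin{cases}\lfloor\delta\rfloor+\{\delta\}^{2/\mathsf v(H)}, & \Delta=2,\\[2pt] \delta^{2/\mathsf v(H)}, & H \text{ is } \Delta\text{-regular and } \Delta\ge 3,\\[2pt] \infty, & \text{otherwise.}\end{cases}$$
   Context: Graphs are finite and simple. For a graph $H$ with vertex set $[\mathsf v(H)]$ and edge set $E(H)$, write $\mathsf v(H)=|V(H)|$ and $\mathsf e(H)=|E(H)|$. $\lfloor\delta\rfloor$ and $\{\delta\}=\delta-\lfloor\delta\rfloor$ are the integer and fractional parts of $\delta$. $a_n\ll b_n$ means $a_n/b_n\to0$. $\mathcal X_n$ is the set of symmetric $n\times n$ matrices $X=(x_{ij})$ with entries in $[0,1]$ and zero diagonal. $\mathcal X_n^d:=\{X\in\mathcal X_n:\ \sum_{i=1}^n x_{ij}=d \text{ for all } 1\le j\le n\}$. For $X\in\mathcal X_n$ and $p\in(0,1)$, $$\mathrm{hom}(H,X):=n^{-\mathsf v(H)}p^{-\mathsf e(H)}\sum_{\phi:[\mathsf v(H)]\to[n]}\ \prod_{(k,l)\in E(H)}X(\phi(k),\phi(l)),$$ where the product has one factor per edge, and $$I_p(X):=\sum_{1\le i\ne j\le n}I_p(x_{ij}),\qquad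 I_p(x):=x\log\frac xp+(1-x)\log\frac{1-x}{1-p}\quad(0\log0:=0).$$ With $p=d/n$, $$\Phi_n^d(H,t):=\tfrac12\inf\{I_p(X):\ X\in\mathcal X_n^d,\ \mathrm{hom}(H,X)\ge t\}\quad(\inf\emptyset=+\infty),$$ $a_{n,p}:=n^2p^{\Delta}\log(1/p)$, and $\phi_n^d(H,t):=a_{n,p}^{-1}\Phi_n^d(H,t)$. *)

(* Defs.v *)
From HB Require Import structures.
From mathcomp Require Import all_boot all_order all_algebra.
From mathcomp Require Import all_classical all_reals all_analysis.

Set Implicit Arguments.
Unset Strict Implicit.
Unset Printing Implicit Defensive.

Import Order.TTheory GRing.Theory Num.Theory.
Import numFieldNormedType.Exports.

Local Open Scope classical_set_scope.
Local Open Scope ring_scope.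

Record sgraph := SGraph {
  nv : nat;
  adj : rel 'I_nv;
  adj_sym : symmetric adj;
  adj_irr : irreflexive adj }.

Section Graph.
Variable H : sgraph.

(* Each undirected edge occurs once, as the pair listing its smaller endpoint
   first. *)
Definition edges : {set 'I_(nv H) * 'I_(nv H)} :=
  [set kl : 'I_(nv H) * 'I_(nv H) | (kl.1 < kl.2)%N && adj kl.1 kl.2].

Definition ne : nat := #|edges|.

Definition deg (x : 'I_(nv H)) : nat := #|[set y | adj x y]|.

Definition maxdeg : nat := \max_(x < nv H) deg x.

Definition gconnected : Prop :=
  (0 < nv H)%N /\ forall x y : 'I_(nv H), connect (@adj H) x y.

Definition gregular (k : nat) : bool := [forall x, deg x == k].

End Graph.

Section Variational.
Variable R : realType.

Definition Xset (n : nat) : set 'M[R]_n :=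
  [set X | [/\ (forall i j, X i j = X j i),
               (forall i j, 0 <= X i j <= 1) &
               (forall i, X i i = 0)]].

Definition Xdset (n : nat) (d : R) : set 'M[R]_n :=
  [set X | Xset X /\ forall j, \sum_(i < n) X i j = d].

Definition homdens (n : nat) (p : R) (H : sgraph) (X : 'M[R]_n) : R :=
  n%:R ^- nv H * p ^- ne H *
  \sum_(phi : {ffun 'I_(nv H) -> 'I_n})
    \prod_(kl in edges H) X (phi kl.1) (phi kl.2).

(* The convention 0 log 0 = 0 holds automatically, as ln is total. *)
Definition Ient (p x : R) : R :=
  x * ln (x / p) + (1 - x) * ln ((1 - x) / (1 - p)).

Definition Imx (n : nat) (p : R) (X : 'M[R]_n) : R :=
  \sum_(i < n) \sum_(j < n | i != j) Ient p (X i j).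

Definition Phi (n : nat) (d : R) (H : sgraph) (t : R) : \bar R :=
  let p := d / n%:R in
  ((2^-1)%:E * ereal_inf [set (Imx p X)%:E | X in
                           [set X : 'M[R]_n | Xdset d X /\ (t <= homdens p H X)%R]])%E.

Definition anp (n : nat) (p : R) (H : sgraph) : R :=
  n%:R ^+ 2 * p ^+ maxdeg H * ln (p^-1).

Definition phi (n : nat) (d : R) (H : sgraph) (t : R) : \bar R :=
  (((anp n (d / n%:R) H)^-1)%:E * Phi n d H t)%E.

Definition intpart (x : R) : R := (Num.floor x)%:~R.

Definition fracpart (x : R) : R := x - intpart x.

Definition cd (H : sgraph) (delta : R) : \bar R :=
  ((2^-1)%:E *
   (if maxdeg H == 2%N then
      (intpart delta + fracpart delta `^ (2 / (nv H)%:R))%:E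
    else if gregular H (maxdeg H) && (3 <= maxdeg H)%N then
      (delta `^ (2 / (nv H)%:R))%:E
    else +oo))%E.

Definition much_less (a b : nat -> R) : Prop :=
  a n / b n @[n --> \oo] --> (0 : R).

End Variational.

(* Main.v *)
Require Import Defs.
From HB Require Import structures.
From mathcomp Require Import all_boot all_order all_algebra.
From mathcomp Require Import all_classical all_reals all_analysis.
From mathcomp Require Import complex zify ring lra.

(** Write X = p + U with p = d / n, so that the rows of U sum to 0 exactly, the
    diagonal included.  Expanding the product over the edges gives
      hom(H, X) = sum over F in E(H) of p^-|F| t(F, U),
    where t(F, U) is the average over all maps phi of the product of
    U(phi k, phi l) over the edges kl of F.  Assume that the entropy of X is
    O(n^2 p^D ln (1/p)), D being the maximal degree.  The inequality
    I_p(x) >= (1 - o(1)) (x - p)^2 ln (1/p) (Ient_ge_sqr) turns this into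
    S := avg U^2 = O(p^D).

    A subgraph F with a vertex of degree 1 has t(F, U) = 0 because of the row
    sums (tdens_leaf).  Finner's inequality gives
    |t(F, U)| <= S^(|F|/D) = O(p^|F|) for all F, and a vertex of degree k in F
    with 2 <= k < D improves this by a power of p, since a row of U has
    average square at most 2p (tdens_low_degree).  What remains are subgraphs
    with all degrees 0 or D, and by connectivity such an F is empty, or H is
    regular and F = E(H).  Hence hom(H, X) = 1 + p^-e(H) t(H, U) + o(1) for
    regular H, and hom(H, X) = 1 + o(1) otherwise (homdens_approx); the latter
    explains the infinite limit.

    For regular H the question is how small S can be when
    t(H, U) >= delta p^e(H) (tdens_extremal).  If D >= 3, Finner's inequality
    t(H, U) <= S^(v/2) is the answer.  If D = 2, then t(H, U) is the power
    sum of order v of the eigenvalues of U / n, whose squares sum to S; they are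
    at most p in modulus because they are eigenvalues of X / n too, and a
    concavity argument (stair_sum) produces the integer and fractional
    parts of delta.

    Conversely, plant disjoint cliques of total size of order n p^(D/2), and
    spread what every vertex lacks evenly outside of the cliques
    (planted).  Everything except the cliques themselves perturbs U by
    o(p^D) in average square and costs O(n^2 p^D) in entropy, so the cliques
    alone determine both the density and the leading term of the cost
    (upper_bound_det). *)

Set Implicit Arguments.
Unset Strict Implicit.
Unset Printing Implicit Defensive.

Import Order.TTheory GRing.Theory Num.Theory.
Import numFieldNormedType.Exports.

Local Open Scope ring_scope.

(** * Averages over finite functions, one coordinate at a time *)

Section Averaging.
Variables (R : realType) (I T : finType).
Implicit Types (f g : {ffun I -> T} -> R) (phi : {ffun I -> T}) (x y : I) (a : T).

Definition upd x a (phi : {ffun I -> T}) : {ffun I -> T} :=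
  [ffun y => if y == x then a else phi y].

Definition avgT (g : T -> R) : R := #|T|%:R^-1 * \sum_a g a.

Definition avg_at x f : {ffun I -> T} -> R :=
  fun phi => avgT (fun a => f (upd x a phi)).

Definition avg f : R := #|T|%:R ^- #|I| * \sum_phi f phi.

Definition indep x f := forall phi a, f (upd x a phi) = f phi.

Lemma updE x a phi y : upd x a phi y = if y == x then a else phi y.
Proof. by rewrite ffunE. Qed.

Lemma upd_id x phi : upd x (phi x) phi = phi.
Proof. by apply/ffunP=> y; rewrite updE; case: eqP => // ->. Qed.

Lemma updK x a b phi : upd x a (upd x b phi) = upd x a phi.
Proof. by apply/ffunP=> y; rewrite !updE; case: eqP. Qed.

Lemma updC x y a b phi : x != y -> upd x a (upd y b phi) = upd y b (upd x a phi).
Proof.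
move=> xy; apply/ffunP=> z; rewrite !updE.
by case: eqP => // ->; rewrite (negPf xy).
Qed.

Lemma avgT_const c : (0 < #|T|)%N -> avgT (fun=> c) = c.
Proof.
move=> T0; rewrite /avgT sumr_const -[c *+ _]mulr_natl mulKf //.
by rewrite pnatr_eq0 -lt0n.
Qed.

Lemma avgT_eq (g h : T -> R) : g =1 h -> avgT g = avgT h.
Proof. by move=> gh; rewrite /avgT (eq_bigr _ (fun a _ => gh a)). Qed.

Lemma ler_avgT (g h : T -> R) : (forall a, g a <= h a) -> avgT g <= avgT h.
Proof.
by move=> gh; apply: ler_wpM2l; [rewrite invr_ge0 ler0n | apply: ler_sum].
Qed.

Lemma avgT_ge0 (g : T -> R) : (forall a, 0 <= g a) -> 0 <= avgT g.
Proof. by move=> g0; rewrite mulr_ge0 ?invr_ge0 ?ler0n ?sumr_ge0. Qed.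

Lemma avgTZ c (g : T -> R) : avgT (fun a => c * g a) = c * avgT g.
Proof. by rewrite /avgT -mulr_sumr mulrCA. Qed.

Lemma avgTZr c (g : T -> R) : avgT (fun a => g a * c) = avgT g * c.
Proof. by rewrite /avgT -mulr_suml mulrA. Qed.

Lemma avg_eq f g : f =1 g -> avg f = avg g.
Proof. by move=> fg; rewrite /avg (eq_bigr _ (fun phi _ => fg phi)). Qed.

Lemma ler_avg f g : (forall phi, f phi <= g phi) -> avg f <= avg g.
Proof.
move=> fg; apply: ler_wpM2l; last exact: ler_sum.
by rewrite invr_ge0 exprn_ge0.
Qed.

Lemma avg_ge0 f : (forall phi, 0 <= f phi) -> 0 <= avg f.
Proof. by move=> f0; rewrite mulr_ge0 ?invr_ge0 ?exprn_ge0 ?sumr_ge0. Qed.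

Lemma avgZ c f : avg (fun phi => c * f phi) = c * avg f.
Proof. by rewrite /avg -mulr_sumr mulrCA. Qed.

Lemma avg_sum (J : Type) (s : seq J) (P : pred J)
    (g : J -> {ffun I -> T} -> R) :
  avg (fun phi => \sum_(j <- s | P j) g j phi) = \sum_(j <- s | P j) avg (g j).
Proof. by rewrite /avg exchange_big /= mulr_sumr. Qed.

Lemma avg_const c : (0 < #|T|)%N -> avg (fun=> c) = c.
Proof.
move=> T0; rewrite /avg sumr_const -[c *+ _]mulr_natl card_ffun natrX mulKf //.
by rewrite expf_neq0 // pnatr_eq0 -lt0n.
Qed.

Lemma ler_norm_avg f : `|avg f| <= avg (fun phi => `|f phi|).
Proof.
rewrite /avg normrM ger0_norm ?invr_ge0 ?exprn_ge0 //.
by apply: ler_wpM2l; [rewrite invr_ge0 exprn_ge0|apply: ler_norm_sum].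
Qed.

(** Swapping the value of phi at x with an auxiliary point a is an involution
    of the pairs (phi, a). *)
Lemma avg_avg_at x f : (0 < #|T|)%N -> avg (avg_at x f) = avg f.
Proof.
move=> T0; rewrite /avg /avg_at /avgT -mulr_sumr; congr (_ * _).
rewrite pair_big /=.
pose h (q : {ffun I -> T} * T) := (upd x q.2 q.1, q.1 x).
have hK : involutive h.
  by case=> phi a; rewrite /h /= updK upd_id updE eqxx.
rewrite (reindex_inj (inv_inj hK)) /=.
under eq_bigr do rewrite updK upd_id.
rewrite -(pair_big xpredT xpredT (fun phi (_ : T) => f phi)) /=.
under eq_bigr do rewrite sumr_const -mulr_natl.
by rewrite -mulr_sumr mulKf // pnatr_eq0 -lt0n.
Qed.

Lemma indep_avg_at x f : indep x (avg_at x f).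
Proof. by move=> phi a; apply: avgT_eq => b; rewrite updK. Qed.

Lemma indep_avg_at2 x y f : indep x f -> indep x (avg_at y f).
Proof.
move=> fx; have [<-|xy] := eqVneq x y; first exact: indep_avg_at.
by move=> phi a; apply: avgT_eq => b; rewrite -updC // fx.
Qed.

Lemma avg_at_indep x f phi :
  (0 < #|T|)%N -> indep x f -> avg_at x f phi = f phi.
Proof.
by move=> T0 fx; rewrite /avg_at (avgT_eq (fun a => fx phi a)) avgT_const.
Qed.

Lemma indep_all_const f phi : (0 < #|T|)%N ->
  (forall x, indep x f) -> f phi = avg f.
Proof.
move=> T0 ind; rewrite -(avg_const (f phi) T0); apply: avg_eq => psi.
pose mix (s : seq I) : {ffun I -> T} :=
  [ffun y => if y \in s then psi y else phi y].
have fmix s : f (mix s) = f phi.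
  elim: s => [|x s <-]; first by congr f; apply/ffunP=> y; rewrite ffunE.
  rewrite -(ind x (mix s) (psi x)); congr f; apply/ffunP=> y.
  by rewrite !ffunE inE; case: eqP => // ->.
by rewrite -(fmix (enum I)); congr f; apply/ffunP=> y; rewrite ffunE mem_enum.
Qed.

End Averaging.

(** * Finner's inequality *)

Section Finner.
Variable R : realType.

(** Weighted AM-GM, from ln x <= x - 1 at each r j / A, where A is the
    right-hand side.  The weights 1/k add up to at most 1, and the missing
    weight sits at the value 1. *)
Lemma prod_powR_le (J : finType) (D : {set J}) (k : nat) (r : J -> R) :
  (#|D| <= k)%N -> (0 < k)%N -> (forall j, 0 <= r j) ->
  \prod_(j in D) r j `^ k%:R^-1 <= 1 + k%:R^-1 * \sum_(j in D) (r j - 1).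
Proof.
move=> Dk k0 r0; set w : R := k%:R^-1.
have k0' : (0 : R) < k%:R by rewrite ltr0n.
have w0 : 0 < w by rewrite invr_gt0.
set A := (X in _ <= X).
have AE : A = (1 - w * #|D|%:R) + w * \sum_(j in D) r j.
  by rewrite /A sumrB sumr_const mulrBr -mulr_natl mulr1; ring.
have D1 : 0 <= 1 - w * #|D|%:R.
  by rewrite subr_ge0 mulrC ler_pdivrMr // mul1r ler_nat.
have S0 : 0 <= \sum_(j in D) r j by apply: sumr_ge0.
have A0 : 0 <= A by rewrite AE addr_ge0 // mulr_ge0 // ltW.
case: (boolP [exists j in D, r j == 0]) => [/existsP[j /andP[jD /eqP rj]]|].
  by rewrite (bigD1 j) //= rj powR0 ?gt_eqF // mul0r.
rewrite negb_exists => /forallP rn0.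
have {}rn0 j : j \in D -> 0 < r j.
  move=> jD; rewrite lt_neqAle eq_sym r0 andbT.
  by have := rn0 j; rewrite jD.
have {}A0 : 0 < A.
  have [D0|/finset.set0Pn[j jD]] := eqVneq D finset.set0.
    by rewrite /A D0 big_set0 mulr0 addr0.
  rewrite AE ltr_wpDl // mulr_gt0 // (bigD1 j) //= ltr_pwDl ?rn0 //.
  exact: sumr_ge0.
have -> : \prod_(j in D) r j `^ w = expR (\sum_(j in D) w * ln (r j)).
  rewrite expR_sum; apply: eq_bigr => j jD.
  by rewrite /powR gt_eqF ?rn0.
rewrite -[X in _ <= X]lnK ?posrE // ler_expR.
have lnA j : j \in D -> w * ln (r j) <= w * (r j / A - 1) + w * ln A.
  move=> jD; rewrite -mulrDr ler_pM2l // -lerBlDr -ln_div ?posrE ?rn0 //.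
  have := @le_ln1Dx R (r j / A - 1); rewrite subrKC; apply.
  by rewrite ltrBrDl subrr divr_gt0 ?rn0.
have lnA1 : (1 - w * #|D|%:R) * - ln A <= (1 - w * #|D|%:R) * (A^-1 - 1).
  rewrite ler_wpM2l // -lnV ?posrE //.
  have := @le_ln1Dx R (A^-1 - 1); rewrite subrKC; apply.
  by rewrite ltrBrDl subrr invr_gt0.
have lnS : \sum_(j in D) w * ln (r j) <=
    \sum_(j in D) (w * (r j / A - 1) + w * ln A) by apply: ler_sum.
rewrite big_split /= sumr_const -mulr_natl in lnS.
have E : \sum_(j in D) w * (r j / A - 1) =
    1 - (1 - w * #|D|%:R) * A^-1 - w * #|D|%:R.
  rewrite -mulr_sumr sumrB -mulr_suml sumr_const.
  have wS : w * (\sum_(j in D) r j) = A - (1 - w * #|D|%:R) by rewrite AE; ring.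
  by rewrite mulrBr mulrA wS mulrBl mulfV ?gt_eqF.
rewrite {}E in lnS.
lra.
Qed.

(** Divide every factor by its average: the constant factors become 1, and
    weighted AM-GM bounds the product of the others by a function of
    average 1. *)
Lemma hoelder_avg (T J : finType) (A D : {set J}) (k : nat) (g : J -> T -> R) :
  (0 < #|T|)%N -> (0 < k)%N -> (#|D| <= k)%N -> D \subset A ->
  (forall j a, j \in A -> 0 <= g j a) ->
  (forall j a b, j \in A -> j \notin D -> g j a = g j b) ->
  avgT (fun a => \prod_(j in A) g j a `^ k%:R^-1) <=
  \prod_(j in A) avgT (g j) `^ k%:R^-1.
Proof.
move=> T0 k0 Dk DA g0 gD.
have N0 : (#|T|%:R : R) != 0 by rewrite pnatr_eq0 -lt0n.
have w0 : k%:R^-1 != 0 :> R by rewrite invr_eq0 pnatr_eq0 -lt0n.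
case: (boolP [exists j in A, avgT (g j) == 0]) => [/existsP[j /andP[jA /eqP gj]]|].
  have g0j a : g j a = 0.
    move: gj => /eqP; rewrite mulf_eq0 invr_eq0 (negPf N0) /= psumr_eq0 => [|b _].
      by move=> /allP/(_ a); rewrite mem_index_enum => /(_ isT)/eqP.
    exact: g0.
  rewrite [X in X <= _](_ : _ = 0) ?prodr_ge0 // => [j' _|]; first exact: powR_ge0.
  rewrite (@avgT_eq _ _ _ (fun=> 0)) ?avgT_const // => a.
  by rewrite (bigD1 j) //= g0j powR0 // mul0r.
rewrite negb_exists => /forallP mn0.
have {}mn0 j : j \in A -> 0 < avgT (g j).
  move=> jA; rewrite lt_neqAle eq_sym avgT_ge0 => [|a]; last exact: g0.
  by have := mn0 j; rewrite jA andbT.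
have P0 : 0 < \prod_(j in A) avgT (g j) `^ k%:R^-1.
  by apply: prodr_gt0 => j jA; rewrite powR_gt0 ?mn0.
rewrite -[leRHS]mul1r -ler_pdivrMr // -avgTZr.
have ratio a : (\prod_(j in A) g j a `^ k%:R^-1) / (\prod_(j in A) avgT (g j) `^ k%:R^-1)
    = \prod_(j in D) (g j a / avgT (g j)) `^ k%:R^-1.
  rewrite -prodf_div (big_setID D) /= [X in _ * X]big1 ?mulr1 => [|j]; last first.
    rewrite inE => /andP[jD jA].
    have -> : avgT (g j) = g j a.
      by rewrite (@avgT_eq _ _ _ (fun=> g j a)) ?avgT_const // => b; apply: gD.
    rewrite divff // gt_eqF // powR_gt0 //.
    have := mn0 _ jA; rewrite (@avgT_eq _ _ _ (fun=> g j a)) ?avgT_const // => b.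
    exact: gD.
  rewrite (finset.setIidPr DA); apply: eq_bigr => j jD.
  have jA := fintype.subsetP DA _ jD.
  rewrite powRM ?g0 ?invr_ge0 ?(ltW (mn0 _ jA)) //; congr (_ * _).
  by rewrite -(powR_inv1 (ltW (mn0 _ jA))) powRAC powR_inv1 ?powR_ge0.
rewrite (avgT_eq ratio).
pose r a j := if j \in D then g j a / avgT (g j) else 0.
apply: (@le_trans _ _ (avgT (fun a => 1 + k%:R^-1 * \sum_(j in D) (r a j - 1)))).
  apply: ler_avgT => a; rewrite (eq_bigr (fun j => r a j `^ k%:R^-1)) => [|j jD].
    apply: prod_powR_le => // j; rewrite /r; case: ifP => // jD.
    have jA := fintype.subsetP DA _ jD.
    by rewrite divr_ge0 ?g0 ?(ltW (mn0 _ jA)).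
  by rewrite /r jD.
rewrite /avgT big_split /= -mulr_sumr exchange_big /= [X in _ + _ * X]big1 => [|j jD].
  by rewrite mulr0 addr0 sumr_const -[1 *+ _]mulr_natl mulr1 mulVf.
rewrite sumrB sumr_const -mulr_natl mulr1 /r jD -mulr_suml.
have jA := fintype.subsetP DA _ jD.
have E : \sum_a g j a = #|T|%:R * avgT (g j) by rewrite /avgT mulVKf.
by rewrite E mulfK ?subrr // gt_eqF ?mn0.
Qed.

Variables (I T J : finType).
Hypothesis T0 : (0 < #|T|)%N.

(** Hölder in the coordinate x alone; the factors that do not depend on x are
    constant along it. *)
Lemma finner_step (A : {set J}) (k : nat) (dep : J -> I -> bool) (x : I)
    (G : J -> {ffun I -> T} -> R) :
  (0 < k)%N -> (#|[set j in A | dep j x]| <= k)%N ->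
  (forall j phi, j \in A -> 0 <= G j phi) ->
  (forall j, j \in A -> ~~ dep j x -> indep x (G j)) ->
  avg (fun phi => \prod_(j in A) G j phi `^ k%:R^-1) <=
  avg (fun phi => \prod_(j in A) avg_at x (G j) phi `^ k%:R^-1).
Proof.
move=> k0 Ak G0 Gdep; rewrite -(avg_avg_at x) //; apply: ler_avg => phi.
apply: (hoelder_avg (D := [set j in A | dep j x])) => //.
- by apply/fintype.subsetP => j; rewrite inE => /andP[].
- by move=> j a; apply: G0.
- move=> j a b jA; rewrite inE jA /= => nd.
  by rewrite !Gdep.
Qed.

(** Averaging over the coordinates one after the other never decreases the
    average of the product and never creates new dependencies; at the end all
    factors are constant. *)
Lemma finner (A : {set J}) (k : nat) (dep : J -> I -> bool)
    (G : J -> {ffun I -> T} -> R) :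
  (0 < k)%N -> (forall x, #|[set j in A | dep j x]| <= k)%N ->
  (forall j phi, j \in A -> 0 <= G j phi) ->
  (forall j x, j \in A -> ~~ dep j x -> indep x (G j)) ->
  avg (fun phi => \prod_(j in A) G j phi `^ k%:R^-1) <=
  \prod_(j in A) avg (G j) `^ k%:R^-1.
Proof.
move=> k0 Ak G0 Gdep.
pose Gs s j := foldr (@avg_at R I T) (G j) s.
have Gs0 s j phi : j \in A -> 0 <= Gs s j phi.
  move=> jA; elim: s phi => [|x s IH] phi /=; first exact: G0.
  by apply: avgT_ge0 => a; apply: IH.
have Gsdep s j x : j \in A -> ~~ dep j x -> indep x (Gs s j).
  move=> jA ndep; elim: s => [|y s IH] /=; first exact: Gdep.
  exact: indep_avg_at2.
have Gsin s j x : x \in s -> indep x (Gs s j).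
  elim: s => [|y s IH] //=; rewrite inE => /orP[/eqP ->|/IH].
    exact: indep_avg_at.
  exact: indep_avg_at2.
have Gsavg s j : avg (Gs s j) = avg (G j).
  by elim: s => //= y s IH; rewrite avg_avg_at.
have step s : avg (fun phi => \prod_(j in A) G j phi `^ k%:R^-1) <=
    avg (fun phi => \prod_(j in A) Gs s j phi `^ k%:R^-1).
  elim: s => [|x s IH] //=; apply: le_trans IH _.
  apply: (finner_step (dep := dep)) => //; first by move=> j phi; apply: Gs0.
  by move=> j; apply: Gsdep.
apply: le_trans (step (enum I)) _.
rewrite (@avg_eq _ _ _ _ (fun=> \prod_(j in A) avg (G j) `^ k%:R^-1)).
  by rewrite avg_const.
move=> phi; apply: eq_bigr => j jA; congr (_ `^ _).
rewrite -(Gsavg (enum I)); apply: indep_all_const => // x.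
by apply: Gsin; rewrite mem_enum.
Qed.

End Finner.

(** * Homomorphism densities of the subgraphs of H *)

Section HomDensity.
Variables (R : realType) (H : sgraph) (n : nat).
Hypothesis n0 : (0 < n)%N.
Local Notation V := 'I_(nv H).
Implicit Types (F : {set V * V}) (f : V * V -> 'I_n -> 'I_n -> R)
  (g U : 'I_n -> 'I_n -> R) (x : V) (e : V * V).

Definition incident x e : bool := (e.1 == x) || (e.2 == x).

Definition star F x : {set V * V} := [set e in F | incident x e].

(** The function may vary with the edge, which allows to perturb U on some
    edges only. *)
Definition tdens F f : R :=
  avg (fun phi : {ffun V -> 'I_n} => \prod_(e in F) f e (phi e.1) (phi e.2)).

Definition avg2 g : R := avgT (fun i => avgT (g i)).

Lemma cardT0 : (0 < #|'I_n|)%N. Proof. by rewrite card_ord. Qed.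
Hint Resolve cardT0 : core.

Lemma edge_neq F e : F \subset edges H -> e \in F -> e.1 != e.2.
Proof.
move=> /fintype.subsetP FE /FE; rewrite inE => /andP[lt _].
by apply: contraTneq lt => ->; rewrite ltnn.
Qed.

Lemma degE x : deg x = #|[set y | adj x y]|.
Proof.
by apply: eq_card => y; rewrite inE; apply/idP/idP => [/set_mem|ay] //; apply/mem_set.
Qed.

Lemma card_star_edges x : #|star (edges H) x| = deg x.
Proof.
pose h (y : V) := if (x < y)%N then (x, y) else (y, x).
have -> : star (edges H) x = h @: [set y | adj x y].
  apply/finset.setP => -[k l]; rewrite !inE /incident /=.
  apply/idP/imsetP => [/andP[/andP[kl akl] /orP[/eqP ek|/eqP el]]|].
  - by exists l; rewrite ?inE -?ek // /h -ek kl.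
  - exists k; first by rewrite inE adj_sym -el.
    by rewrite /h -el ltnNge ltnW.
  - case=> y; rewrite inE => axy; rewrite /h.
    case: ltnP => [xy [-> ->]|yx [-> ->]] /=; first by rewrite xy axy eqxx.
    rewrite adj_sym axy eqxx orbT !andbT ltn_neqAle yx andbT.
    by apply: contraTneq axy => /val_inj ->; rewrite adj_irr.
rewrite degE card_in_imset // => y z; rewrite !inE /h => axy axz.
by case: ltnP => _; case: ltnP => _ [] // -> ->.
Qed.

Lemma card_star_le F x : F \subset edges H -> (#|star F x| <= deg x)%N.
Proof.
move=> /fintype.subsetP FE; rewrite -card_star_edges; apply: subset_leq_card.
by apply/fintype.subsetP=> e; rewrite !inE => /andP[/FE]; rewrite inE => -> ->.
Qed.

Lemma indep_edge x e (g : 'I_n -> 'I_n -> R) : ~~ incident x e ->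
  indep x (fun phi : {ffun V -> 'I_n} => g (phi e.1) (phi e.2)).
Proof.
by rewrite negb_or => /andP[/negPf e1 /negPf e2] phi a; rewrite !updE e1 e2.
Qed.

Lemma avg_edge e g : e.1 != e.2 ->
  avg (fun phi : {ffun V -> 'I_n} => g (phi e.1) (phi e.2)) = avg2 g.
Proof.
move=> e12; rewrite -(avg_avg_at e.2) // -(avg_avg_at e.1) //.
rewrite (@avg_eq _ _ _ _ (fun=> avg2 g)) ?avg_const // => phi.
apply: avgT_eq => i; apply: avgT_eq => j.
by rewrite !updE !eqxx (negPf e12).
Qed.

Lemma norm_tdens_le F U :
  `|tdens F (fun=> U)| <= tdens F (fun=> fun i j => `|U i j|).
Proof.
apply: le_trans (ler_norm_avg _) _.
by apply: ler_avg => phi; rewrite normr_prod.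
Qed.

Lemma root_exprK (D : nat) (a : R) :
  (0 < D)%N -> 0 <= a -> (a ^+ D) `^ D%:R^-1 = a.
Proof.
move=> D0 a0; rewrite -powR_mulrn // -powRrM mulfV ?powRr1 //.
by rewrite pnatr_eq0 -lt0n.
Qed.

(** An edge factor depends on its two endpoints only, so a vertex of degree at
    most D influences at most D factors. *)
Lemma tdens_finner F f (D : nat) : (0 < D)%N -> F \subset edges H ->
  (forall x, (deg x <= D)%N) -> (forall e i j, e \in F -> 0 <= f e i j) ->
  tdens F f <=
  \prod_(e in F) avg2 (fun i j => f e i j ^+ D) `^ D%:R^-1.
Proof.
move=> D0 FE degD f0.
pose G e (phi : {ffun V -> 'I_n}) := f e (phi e.1) (phi e.2) ^+ D.
have -> : tdens F f = avg (fun phi => \prod_(e in F) G e phi `^ D%:R^-1).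
  apply: avg_eq => phi; apply: eq_bigr => e eF.
  by rewrite /G root_exprK // f0.
rewrite (_ : \prod_(e in F) _ = \prod_(e in F) avg (G e) `^ D%:R^-1); last first.
  apply: eq_bigr => e eF; congr (_ `^ _).
  by rewrite -(@avg_edge e) // (edge_neq FE).
apply: (finner cardT0 (dep := fun e x => incident x e)) => //.
- by move=> x; apply: leq_trans (degD x); apply: card_star_le.
- by move=> e phi eF; apply: exprn_ge0; apply: f0.
- by move=> e x eF; apply: (indep_edge (fun i j => f e i j ^+ D)).
Qed.

Lemma avg2_ge0 g : (forall i j, 0 <= g i j) -> 0 <= avg2 g.
Proof. by move=> g0; apply: avgT_ge0 => i; apply: avgT_ge0. Qed.

Lemma ler_avg2 g g' : (forall i j, g i j <= g' i j) -> avg2 g <= avg2 g'.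
Proof. by move=> gg; apply: ler_avgT => i; apply: ler_avgT. Qed.

Lemma expr_le_sqr (D : nat) (a : R) :
  (2 <= D)%N -> `|a| <= 1 -> `|a| ^+ D <= a ^+ 2.
Proof.
by move=> D2 a1; rewrite -[leRHS]ger0_norm ?sqr_ge0 // normrX ler_wiXn2l.
Qed.

(** Hölder at a vertex b of degree k < D may be used with the exponent 1/k
    instead of 1/D.  It replaces each edge at b by the average of U^2 over the
    row of the other endpoint, to the power 1/k.  These averages are at most r,
    so each of the k edges leaves an extra r^(1/k - 1/D), and
    k (1/k - 1/D) >= 1/D. *)
Lemma tdens_low_degree F U (D : nat) (r : R) (b : V) :
  F \subset edges H -> (forall x, (deg x <= D)%N) ->
  (forall i j, `|U i j| <= 1) -> (forall i j, U i j = U j i) ->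
  (forall i, avgT (fun j => U i j ^+ 2) <= r) -> 0 <= r <= 1 ->
  (2 <= #|star F b| < D)%N ->
  tdens F (fun=> fun i j => `|U i j|) <=
  r `^ D%:R^-1 * avg2 (fun i j => U i j ^+ 2) `^ (#|F|%:R / D%:R).
Proof.
move=> FE degD U1 Usym Ur /andP[r0 r1] /andP[k2 kD].
set k := #|star F b| in k2 kD.
have k0 : (0 < k)%N by apply: leq_trans k2.
have D0 : (0 < D)%N by apply: leq_trans kD.
have [k0R D0R] : (0 : R) < k%:R /\ (0 : R) < D%:R by rewrite !ltr0n.
pose G e (phi : {ffun V -> 'I_n}) := U (phi e.1) (phi e.2) ^+ 2.
have G0 e phi : 0 <= G e phi by apply: sqr_ge0.
have AG0 e phi : 0 <= avg_at b (G e) phi by apply: avgT_ge0.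
have AGr e phi : e \in star F b -> avg_at b (G e) phi <= r.
  rewrite inE => /andP[eF]; have e12 := edge_neq FE eF.
  case/orP => /eqP eb; rewrite -eb; rewrite eq_sym in e12 *.
  - apply: le_trans (Ur (phi e.2)); apply: ler_avgT => a.
    by rewrite /G !updE eqxx (negPf e12) Usym.
  - rewrite eq_sym in e12; apply: le_trans (Ur (phi e.1)); apply: ler_avgT => a.
    by rewrite /G !updE eqxx (negPf e12).
have Gind e : e \in F -> e \notin star F b -> indep b (G e).
  move=> eF; rewrite inE eF => /= ninc.
  exact: (indep_edge (fun i j => U i j ^+ 2)).
pose q : R := k%:R^-1 - D%:R^-1.
have q0 : 0 <= q.
  by rewrite subr_ge0 lef_pV2 ?posrE // ler_nat ltnW.
(* |U|^k <= U^2 because 2 <= k and |U| <= 1. *)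
have step1 : tdens F (fun=> fun i j => `|U i j|) <=
    avg (fun phi => (\prod_(e in F :\: star F b) G e phi `^ D%:R^-1) *
      \prod_(e in star F b) avg_at b (G e) phi `^ k%:R^-1).
  rewrite /tdens -(avg_avg_at b) //; apply: ler_avg => phi.
  pose c := \prod_(e in F :\: star F b) G e phi `^ D%:R^-1.
  have c0 : 0 <= c by apply: prodr_ge0 => e _; apply: powR_ge0.
  apply: (@le_trans _ _ (c * avgT (fun a =>
      \prod_(e in star F b) G e (upd b a phi) `^ k%:R^-1))); last first.
    apply: ler_wpM2l => //.
    by apply: (hoelder_avg (D := star F b)) => // e a b'; case: (e \in star F b).
  rewrite -avgTZ; apply: ler_avgT => a.
  rewrite (big_setID (star F b)) /= mulrC.
  have -> : F :&: star F b = star F b.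
    by apply/finset.setP => e; rewrite !inE; case: (e \in F).
  have nn e : 0 <= `|U (upd b a phi e.1) (upd b a phi e.2)| by [].
  apply: ler_pM; [exact: prodr_ge0|exact: prodr_ge0| |].
  - apply: ler_prod => e; rewrite inE => /andP[es eF]; rewrite nn /=.
    rewrite -(Gind e eF es phi a) -[leLHS](@root_exprK D) //.
    apply: ge0_ler_powR; rewrite ?nnegrE ?G0 ?exprn_ge0 ?invr_ge0 //.
    by apply: expr_le_sqr; rewrite ?U1 // (leq_trans k2 (ltnW kD)).
  - apply: ler_prod => e es; rewrite nn /= -[leLHS](@root_exprK k) //.
    apply: ge0_ler_powR; rewrite ?nnegrE ?G0 ?exprn_ge0 ?invr_ge0 //.
    exact: expr_le_sqr.
apply: le_trans step1 _.
(* Trade the exponent 1/k for 1/D at each of the k edges at b. *)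
have step2 phi : (\prod_(e in F :\: star F b) G e phi `^ D%:R^-1) *
      (\prod_(e in star F b) avg_at b (G e) phi `^ k%:R^-1) <=
    (r `^ q) ^+ k * \prod_(e in F) avg_at b (G e) phi `^ D%:R^-1.
  rewrite [X in _ <= _ * X](big_setID (star F b)) /=.
  have -> : F :&: star F b = star F b.
    by apply/finset.setP => e; rewrite !inE; case: (e \in F).
  rewrite mulrA mulrC; apply: ler_pM.
  - by apply: prodr_ge0 => e _; apply: powR_ge0.
  - by apply: prodr_ge0 => e _; apply: powR_ge0.
  - rewrite -prodr_const -big_split /=; apply: ler_prod => e es.
    rewrite powR_ge0 /=.
    have -> : (k%:R^-1 : R) = q + D%:R^-1 by rewrite /q subrK.
    have [->|A0] := eqVneq (avg_at b (G e) phi) 0.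
      rewrite powR0 ?mulr_ge0 ?powR_ge0 // gt_eqF // ltr_wpDl // invr_gt0 //.
    rewrite powRD; last by rewrite A0 implybT.
    by rewrite ler_wpM2r ?powR_ge0 //; apply: ge0_ler_powR; rewrite ?nnegrE ?AGr.
  - apply: ler_prod => e; rewrite inE => /andP[es eF]; rewrite powR_ge0 /=.
    by rewrite (avg_at_indep _ _ (Gind e eF es)).
apply: le_trans (ler_avg step2) _; rewrite avgZ.
apply: ler_pM; [by rewrite exprn_ge0 ?powR_ge0| | |].
- by apply: avg_ge0 => phi; apply: prodr_ge0 => e _; apply: powR_ge0.
- rewrite -powR_mulrn ?powR_ge0 // -powRrM.
  have [->|rn0] := eqVneq r 0.
    rewrite !powR0 // ?invr_eq0 ?gt_eqF //.
    by rewrite mulr_gt0 // subr_gt0 ltf_pV2 ?posrE // ltr_nat.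
  rewrite ger_powR //; first by rewrite lt_neqAle eq_sym rn0 r0.
  rewrite /q mulrBl mulVf ?gt_eqF // -(ler_pM2r D0R) mulVf ?gt_eqF //.
  rewrite mulrBl mul1r mulrAC mulVf ?gt_eqF // mul1r.
  by rewrite lerBrDr nat1r ler_nat.
- have -> : avg2 (fun i j => U i j ^+ 2) `^ (#|F|%:R / D%:R) =
      \prod_(e in F) avg (avg_at b (G e)) `^ D%:R^-1.
    rewrite mulrC powRrM powR_mulrn ?powR_ge0 // -prodr_const.
    apply: eq_bigr => e eF; congr (_ `^ _).
    by rewrite avg_avg_at // -(@avg_edge e) // (edge_neq FE).
  apply: (finner cardT0 (dep := fun e x => incident x e)) => //.
  + by move=> x; apply: leq_trans (degD x); apply: card_star_le.
  + move=> e x eF ninc; apply: indep_avg_at2.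
    exact: (indep_edge (fun i j => U i j ^+ 2)).
Qed.

(** Averaging over the position of b acts on the factor of its only edge, and
    turns it into a row sum of U. *)
Lemma tdens_leaf F U (b : V) : F \subset edges H ->
  (forall i, \sum_j U i j = 0) -> (forall i j, U i j = U j i) ->
  #|star F b| = 1%N -> tdens F (fun=> U) = 0.
Proof.
move=> FE U0 Usym /eqP/cards1P[e es].
have eF : e \in F.
  by have : e \in star F b by [rewrite es inE]; rewrite inE => /andP[].
have binc : incident b e.
  by have : e \in star F b by [rewrite es inE]; rewrite inE => /andP[].
rewrite /tdens -(avg_avg_at b) //.
rewrite (@avg_eq _ _ _ _ (fun=> 0)) ?avg_const // => phi.
pose c := \prod_(e' in F | e' != e) U (phi e'.1) (phi e'.2).
rewrite /avg_at (@avgT_eq _ _ _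
  (fun a => U (upd b a phi e.1) (upd b a phi e.2) * c)); last first.
  move=> a; rewrite (bigD1 e) //=; congr (_ * _); apply: eq_bigr => e' /andP[e'F e'e].
  apply: (@indep_edge b e' U); apply: contraNN e'e => inc'.
  have : e' \in star F b by rewrite inE e'F.
  by rewrite es inE.
rewrite avgTZr (_ : avgT _ = 0) ?mul0r //.
have e12 := edge_neq FE eF.
case/orP: binc => /eqP eb.
- rewrite /avgT (eq_bigr (fun a => U (phi e.2) a)) ?U0 ?mulr0 // => a _.
  by rewrite !updE eb eqxx -eb eq_sym (negPf e12) Usym.
- rewrite /avgT (eq_bigr (fun a => U (phi e.1) a)) ?U0 ?mulr0 // => a _.
  by rewrite !updE eb eqxx -eb (negPf e12).
Qed.

Lemma prod_distr_powerset (J : finType) (A : {set J}) (f g : J -> R) :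
  \prod_(j in A) (f j + g j) =
  \sum_(B in powerset A) \prod_(j in B) f j * \prod_(j in A :\: B) g j.
Proof.
pose f' j := if j \in A then f j else 0.
pose g' j := if j \in A then g j else 1.
transitivity (\prod_j (f' j + g' j)).
  rewrite big_mkcond; apply: eq_bigr => j _; rewrite /f' /g'.
  by case: ifP => // _; rewrite add0r.
rewrite bigA_distr /= (bigID (fun B : {set J} => B \subset A)) /=.
rewrite [X in _ + X]big1 ?addr0 => [|B]; last first.
  move=> /fintype.subsetPn[j jB jA].
  by rewrite (bigD1 j) //= jB /f' (negPf jA) mul0r.
apply: eq_big => [B|B BA]; first by rewrite powersetE.
rewrite (bigID (mem B)) /=; congr (_ * _).
  apply: eq_bigr => j jB; rewrite jB /f' (fintype.subsetP BA) //.
rewrite (bigID (mem A)) /= [X in _ * X]big1 ?mulr1 => [|j /andP[jB jA]].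
  by apply: eq_big => [j|j /andP[/negPf jB jA]]; rewrite ?inE // jB /g' jA.
by rewrite (negPf jB) /g' (negPf jA).
Qed.

Lemma homdens_expand (p : R) U (X : 'M[R]_n) : p != 0 ->
  (forall i j, X i j = p + U i j) ->
  homdens p H X = \sum_(F in powerset (edges H)) p ^- #|F| * tdens F (fun=> U).
Proof.
move=> p0 XE; rewrite /homdens.
have -> : n%:R ^- nv H * p ^- ne H * (\sum_(phi : {ffun V -> 'I_n})
    \prod_(kl in edges H) X (phi kl.1) (phi kl.2)) =
  avg (fun phi : {ffun V -> 'I_n} => p ^- ne H *
    \prod_(kl in edges H) X (phi kl.1) (phi kl.2)).
  by rewrite avgZ /avg !card_ord mulrAC mulrC mulrA.
rewrite (@avg_eq _ _ _ _ (fun phi : {ffun V -> 'I_n} =>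
   \sum_(F in powerset (edges H)) p ^- #|F| *
     \prod_(e in F) U (phi e.1) (phi e.2))); last first.
  move=> phi; under eq_bigr do rewrite XE addrC.
  rewrite prod_distr_powerset mulr_sumr; apply: eq_bigr => F.
  rewrite powersetE => FE; rewrite mulrCA mulrC; congr (_ * _).
  rewrite prodr_const cardsDS // expfB_cond ?(negPf p0) ?subset_leq_card //.
  by rewrite mulrA mulVf ?mul1r // expf_neq0.
by rewrite avg_sum; apply: eq_bigr => F _; rewrite avgZ.
Qed.

End HomDensity.

(** * Only H itself contributes to the excess *)

Section Approximation.
Variables (R : realType) (H : sgraph) (n : nat).
Hypothesis n0 : (0 < n)%N.
Hypothesis H_conn : gconnected H.
Local Notation V := 'I_(nv H).
Implicit Types (F : {set V * V}) (U : 'I_n -> 'I_n -> R).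

Lemma edge_exists (x y : V) : adj x y ->
  exists e, [/\ e \in edges H, incident x e & incident y e].
Proof.
move=> axy; case: (ltngtP x y) => [xy|yx|/val_inj xy].
- by exists (x, y); rewrite inE /incident /= xy axy !eqxx orbT.
- by exists (y, x); rewrite inE /incident /= yx adj_sym axy !eqxx orbT.
- by move: axy; rewrite xy adj_irr.
Qed.

Lemma connected_ind (P : pred V) (x : V) : P x ->
  (forall y z, adj y z -> P y -> P z) -> forall y, P y.
Proof.
move=> Px step y.
have cl : fingraph.closed (@adj H) P.
  by apply: intro_closed; [exact: sym_connect_sym (@adj_sym H)|exact: step].
by have := closed_connect cl (proj2 H_conn x y); rewrite /in_mem /= Px => <-.
Qed.

(** The vertices that have all their edges in F are closed under adjacency:
    a neighbour has an edge in F, hence has degree D in F. *)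
Lemma full_subgraph F (D : nat) : F \subset edges H -> F != finset.set0 ->
  (forall x : V, (deg x <= D)%N) ->
  (forall x : V, #|star F x| = 0%N \/ #|star F x| = D) ->
  F = edges H /\ forall x : V, deg x = D.
Proof.
move=> FE /finset.set0Pn[e0 e0F] degD starF.
have starFE x : star F x \subset star (edges H) x.
  apply/fintype.subsetP => e; rewrite !inE => /andP[eF ->].
  by have := fintype.subsetP FE _ eF; rewrite inE => ->.
have pos e x : e \in F -> incident x e -> #|star F x| = D.
  move=> eF xe; case: (starF x) => // /eqP; rewrite cards_eq0 => /eqP s0.
  by have : e \in star F x by [rewrite inE eF]; rewrite s0 inE.
have D0 : (0 < D)%N.
  rewrite -(@pos e0 e0.1) // /incident ?eqxx // card_gt0; apply/finset.set0Pn.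
  by exists e0; rewrite inE e0F /incident eqxx.
have eqstar x : #|star F x| = D -> star F x = star (edges H) x.
  move=> sD; apply/eqP; rewrite eqEcard starFE sD.
  by rewrite card_star_edges degD.
have all x : #|star F x| == D.
  apply: (@connected_ind (fun x => #|star F x| == D) e0.1).
    by rewrite (@pos e0) // /incident eqxx.
  move=> y z /edge_exists[e [eE ye ze]] /eqP /eqstar sy.
  have : e \in star F y by rewrite sy inE eE.
  by rewrite inE => /andP[eF _]; rewrite (@pos e).
split; last by move=> x; rewrite -card_star_edges -eqstar ?(eqP (all x)).
apply/eqP; rewrite finset.eqEsubset FE /=; apply/fintype.subsetP => e eE.
have : e \in star F e.1 by rewrite eqstar ?(eqP (all _)) // inE eE /incident eqxx.
by rewrite inE => /andP[].
Qed.

Lemma tdens0 (f : V * V -> _ -> _ -> R) : @tdens R H n finset.set0 f = 1 :> R.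
Proof.
rewrite /tdens (@avg_eq _ _ _ _ (fun=> 1)) ?avg_const ?card_ord // => phi.
by rewrite big_set0.
Qed.

Lemma powR_le_bound (K s p : R) (k m D : nat) : (0 < D)%N -> 1 <= K -> 0 < p ->
  (k <= m)%N -> 0 <= s -> s <= K * p ^+ D ->
  s `^ (k%:R / D%:R) <= K ^+ m * p ^+ k.
Proof.
move=> D0 K1 p0 km s0 sK; have D0R : (0 : R) < D%:R by rewrite ltr0n.
have K0 : 0 < K by apply: lt_le_trans K1.
apply: (@le_trans _ _ ((K * p ^+ D) `^ (k%:R / D%:R))).
  apply: ge0_ler_powR; rewrite ?nnegrE ?divr_ge0 //.
  by rewrite mulr_ge0 ?exprn_ge0 // ltW.
rewrite powRM ?exprn_ge0 ?(ltW p0) ?(ltW K0) //; apply: ler_pM; rewrite ?powR_ge0 //.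
  rewrite -powR_mulrn ?(ltW K0) //; apply: ler_powR => //.
  rewrite ler_pdivrMr // -natrM ler_nat; apply: leq_trans km _.
  by rewrite leq_pmulr.
rewrite -(powR_mulrn _ (ltW p0)) -powRrM mulrCA mulfV ?gt_eqF // mulr1.
by rewrite powR_mulrn // ltW.
Qed.

(** The expansion over F: a vertex of degree 1 in F makes the term vanish, one of
    degree strictly between 1 and D makes it small, and a nonempty F without
    such vertices is all of a regular H. *)
Lemma homdens_approx (X : 'M[R]_n) U (D : nat) (p r K : R) :
  (0 < #|edges H|)%N -> (forall x : V, (deg x <= D)%N) -> (2 <= D)%N ->
  0 < p -> 0 <= r <= 1 -> 1 <= K ->
  (forall i j, X i j = p + U i j) ->
  (forall i j, U i j = U j i) -> (forall i, \sum_j U i j = 0) ->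
  (forall i j, `|U i j| <= 1) -> (forall i, avgT (fun j => U i j ^+ 2) <= r) ->
  avg2 (fun i j => U i j ^+ 2) <= K * p ^+ D ->
  `|homdens p H X - (1 + (if gregular H D then
       p ^- ne H * tdens (edges H) (fun=> U) else 0))| <=
  2 ^+ ne H * K ^+ ne H * r `^ D%:R^-1.
Proof.
move=> E0 degD D2 p0 /[dup] r01 /andP[r0 r1] K1 XU Usym U0 U1 Ur US.
have D0 : (0 < D)%N by apply: leq_trans D2.
have K0 : 0 < K by apply: lt_le_trans K1.
rewrite (homdens_expand H (lt0r_neq0 p0) XU).
pose term F := p ^- #|F| * tdens F (fun=> U).
pose main F := if F == finset.set0 then 1 else
  if gregular H D && (F == edges H) then term F else 0.
have EneqO : edges H != finset.set0 by rewrite -card_gt0.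
have -> : 1 + (if gregular H D then p ^- ne H * tdens (edges H) (fun=> U) else 0)
    = \sum_(F in powerset (edges H)) main F.
  rewrite (bigD1 finset.set0) ?powersetE ?finset.sub0set //= {1}/main eqxx.
  congr (_ + _); rewrite (bigD1 (edges H)) ?powersetE ?fintype.subxx ?EneqO //=.
  rewrite big1 ?addr0 => [|F /andP[/andP[_ FO] FE]].
    by rewrite /main (negPf EneqO) eqxx andbT.
  by rewrite /main (negPf FO) (negPf FE) andbF.
rewrite -sumrB; apply: le_trans (ler_norm_sum _ _ _) _.
set B := K ^+ ne H * r `^ D%:R^-1.
have B0 : 0 <= B by rewrite mulr_ge0 ?powR_ge0 ?exprn_ge0 ?ltW.
apply: (@le_trans _ _ (\sum_(F in powerset (edges H)) B)); last first.
  by rewrite sumr_const card_powerset -[B *+ _]mulr_natl natrX mulrA.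
apply: ler_sum => F; rewrite powersetE => FE.
rewrite /main; case: eqP => [->|/eqP FO].
  by rewrite /term cards0 expr0 invr1 mul1r tdens0 subrr normr0.
case: ifP => [_|nreg]; first by rewrite subrr normr0.
rewrite subr0 /term.
have [[b]|lowF] := pselect (exists b : V, #|star F b| = 1%N).
  by move/(tdens_leaf n0 FE U0 Usym) => ->; rewrite mulr0 normr0.
have [[b kb]|noF] := pselect (exists b : V, (2 <= #|star F b| < D)%N); last first.
  exfalso; move/negP: nreg; apply.
  have [|FE' dD] := @full_subgraph F D FE FO degD.
    move=> x; have : (#|star F x| <= D)%N.
      by apply: leq_trans (degD x); apply: card_star_le.
    rewrite leq_eqVlt => /orP[/eqP|xD]; first by right.
    left; case s: #|star F x| => [|[|k]] //.
      by exfalso; apply: lowF; exists x.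
    by exfalso; apply: noF; exists x; rewrite xD s.
  by rewrite FE' eqxx andbT; apply/forallP => x; rewrite dD.
have low := tdens_low_degree n0 FE degD U1 Usym Ur r01 kb.
have pF0 : 0 < p ^+ #|F| by rewrite exprn_gt0.
rewrite normrM [X in X * _]ger0_norm ?invr_ge0 ?(ltW pF0) // ler_pdivrMl //.
apply: le_trans (norm_tdens_le F U) _; apply: le_trans low _.
rewrite mulrC /B mulrA; apply: ler_wpM2r; first exact: powR_ge0.
have S0 : 0 <= avg2 (fun i j => U i j ^+ 2) by apply: avg2_ge0 => i j; apply: sqr_ge0.
rewrite [leRHS]mulrC; exact: (powR_le_bound D0 K1 p0 (subset_leq_card FE) S0 US).
Qed.

End Approximation.

(** * Quadratic bounds for the relative entropy *)

Section Entropy.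
Variable R : realType.
Implicit Types p x y z L eps : R.

Lemma ln_le_sub1 x : 0 < x -> ln x <= x - 1.
Proof.
by move=> x0; have := @le_ln1Dx R (x - 1); rewrite subrKC; apply; rewrite ltrBrDl subrr.
Qed.

Lemma ln_ge_1subV x : 0 < x -> 1 - x^-1 <= ln x.
Proof.
move=> x0; have := @ln_le_sub1 x^-1; rewrite invr_gt0 => /(_ x0).
by rewrite lnV ?posrE //; lra.
Qed.

(** The right-hand side is the chi-square distance: use ln y <= y - 1 twice. *)
Lemma Ient_le_sqr p x : 0 < p < 1 -> 0 <= x <= 1 ->
  Ient p x <= (x - p) ^+ 2 / (p * (1 - p)).
Proof.
move=> /andP[p0 p1] /andP[x0 x1].
have p1' : 0 < 1 - p by rewrite subr_gt0.
have step (a b : R) : 0 <= a -> 0 < b -> a * ln (a / b) <= a * (a / b - 1).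
  rewrite le_eqVlt => /orP[/eqP <-|a0] b0; first by rewrite !mul0r.
  by rewrite ler_pM2l //; apply: ln_le_sub1; rewrite divr_gt0.
apply: (@le_trans _ _ (x * (x / p - 1) + (1 - x) * ((1 - x) / (1 - p) - 1))).
  by apply: lerD; apply: step => //; rewrite subr_ge0.
rewrite le_eqVlt; apply/orP; left; apply/eqP; field.
by rewrite !gt_eqF.
Qed.

Lemma Ient1 p : Ient p 1 = ln p^-1.
Proof. by rewrite /Ient subrr mul0r addr0 !mul1r. Qed.

(** A linear bound for the second logarithm turns the Bernoulli entropy into the
    Poisson one. *)
Lemma Ient_ge_poisson p x : 0 < p < 1 -> 0 <= x <= 1 ->
  x * ln (x / p) + p - x <= Ient p x.
Proof.
move=> /andP[p0 p1] /andP[x0 x1]; rewrite /Ient -addrA lerD2l.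
have p1' : 0 < 1 - p by rewrite subr_gt0.
move: x1; rewrite le_eqVlt => /orP[/eqP ->|x1]; first by rewrite subrr mul0r; lra.
have x1' : 0 < 1 - x by rewrite subr_gt0.
have := ln_ge_1subV (divr_gt0 x1' p1'); rewrite invf_div.
rewrite -(ler_pM2l x1'); apply: le_trans.
by rewrite mulrBr mulrCA mulfV ?gt_eqF //; lra.
Qed.

Lemma expR_ge_sqr z : 0 <= z -> z ^+ 2 / 4 <= expR z.
Proof.
move=> z0; have -> : z = z / 2 + z / 2 by rewrite -splitr.
rewrite expRD -expr2.
have h : z / 2 <= expR (z / 2) by apply: le_trans (expR_ge1Dx _); lra.
have -> : (z / 2 + z / 2) ^+ 2 / 4 = (z / 2) ^+ 2 by field.
by rewrite ler_sqr ?nnegrE ?expR_ge0 //; lra.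
Qed.

Lemma mul_expRN_le L eps : 0 < eps -> 0 < L ->
  L * expR (- (eps * L)) <= 4 / (eps ^+ 2 * L).
Proof.
move=> e0 L0; rewrite expRN ler_pdivrMr ?expR_gt0 //.
have := expR_ge_sqr (ltW (mulr_gt0 e0 L0)) => h.
rewrite mulrAC ler_pdivlMr ?mulr_gt0 ?exprn_gt0 //.
have -> : L * (eps ^+ 2 * L) = 4 * ((eps * L) ^+ 2 / 4) by field.
by rewrite ler_pM2l.
Qed.

(** The inequality ln y >= 1 - 1/y at y = sqrt (x / p) bounds the Poisson
    entropy below by the squared Hellinger distance p (y - 1)^2, and
    x - p = p (y - 1) (y + 1). *)
Lemma Ient_ge_near p x c : 0 < p < 1 -> 0 <= x <= 1 -> 0 <= c ->
  x <= c ^+ 2 * p -> (x - p) ^+ 2 <= (c + 1) ^+ 2 * p * Ient p x.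
Proof.
move=> p01 x01 c0 xc.
apply: le_trans (ler_wpM2l _ (Ient_ge_poisson p01 x01)); last first.
  by rewrite mulr_ge0 ?sqr_ge0 //; lra.
case/andP: p01 => p0 p1; case/andP: x01 => x0 x1.
pose y := Num.sqrt (x / p).
have xE : x = p * y ^+ 2 by rewrite sqr_sqrtr ?divr_ge0 ?(ltW p0) // mulrC divfK ?gt_eqF.
have y0 : 0 <= y by apply: sqrtr_ge0.
have yc : y <= c.
  rewrite -[c]ger0_norm // -sqrtr_sqr; apply: ler_wsqrtr.
  by rewrite ler_pdivrMr.
have lnx : p * (2 * y ^+ 2 - 2 * y) <= x * ln (x / p).
  move: y0; rewrite le_eqVlt => /orP[/eqP y0|y0].
    by rewrite xE -y0 expr0n /= !(mulr0, mul0r) subr0 mulr0.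
  have -> : x / p = y ^+ 2 by rewrite {1}xE mulrC mulKf ?gt_eqF.
  rewrite lnXn // {1}xE -mulrA ler_pM2l //.
  have := ln_ge_1subV y0; rewrite -(ler_pM2l (exprn_gt0 2 y0)).
  rewrite mulrBr mulr1 expr2 mulfK ?gt_eqF // -mulr_natl => h; lra.
have h : p * (y - 1) ^+ 2 <= x * ln (x / p) + p - x by rewrite {3}xE; lra.
apply: le_trans (ler_wpM2l _ h); last first.
  by rewrite mulr_ge0 ?sqr_ge0 //; lra.
rewrite xE (_ : p * y ^+ 2 - p = p * (y - 1) * (y + 1)); last by ring.
rewrite exprMn [leRHS](_ : _ = (p * (y - 1)) ^+ 2 * (c + 1) ^+ 2); last by ring.
apply: ler_wpM2l; first exact: sqr_ge0.
by rewrite ler_sqr ?nnegrE; lra.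
Qed.

(** Asymptotically sharp at x = 1.  Up to x = e^2 p the
    Hellinger bound is much better, because p ln (1/p) is small.  Beyond,
    x (ln x + L - 1) has to exceed (1 - eps) x^2 L with L = ln (1/p): either
    ln x >= 1 - eps L, and ln x + L - 1 >= (1 - eps) L; or x is so small
    that x L <= 1, whereas ln x + L - 1 >= 1. *)
Lemma Ient_ge_sqr eps : 0 < eps < 1 -> exists2 L0 : R, 0 < L0 &
  forall p x, 0 < p < 1 -> L0 <= ln p^-1 -> 0 <= x <= 1 ->
  (1 - eps) * (x - p) ^+ 2 * ln p^-1 <= Ient p x.
Proof.
move=> /andP[e0 e1]; pose c : R := expR 1; pose C : R := (c + 1) ^+ 2.
have c0 : 0 < c by apply: expR_gt0.
have C0 : 0 < C by apply: exprn_gt0; lra.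
have ce0 : 0 < 4 * c / eps ^+ 2 by rewrite divr_gt0 ?mulr_gt0 ?exprn_gt0.
exists (4 * C + 4 * c / eps ^+ 2); first by lra.
move=> p x /[dup] p01 /andP[p0 p1]; set L := ln p^-1 => L0 /[dup] x01 /andP[x0 x1].
have Lp : 0 < L by lra.
have pE : p = expR (- L) by rewrite /L lnV ?posrE // opprK lnK.
have sq0 : 0 <= (x - p) ^+ 2 by apply: sqr_ge0.
have pos0 : 0 <= (1 - eps) * (x - p) ^+ 2 by rewrite mulr_ge0 //; lra.
have [near|far] := leP x (c ^+ 2 * p).
  have CpL : C * p * L <= 1.
    have := mul_expRN_le ltr01 Lp; rewrite !mul1r expr1n mul1r -pE.
    rewrite ler_pdivlMr // => h.
    have : C * (L * p) * 4 <= 4 * 1 ; last by lra.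
    have : (L * p) * (4 * C) <= L * p * L; last by lra.
    by rewrite ler_wpM2l ?mulr_ge0 ?ltW //; lra.
  have h := Ient_ge_near p01 x01 (ltW c0) near.
  have I0 : 0 <= Ient p x.
    have CP : 0 < C * p by rewrite mulr_gt0.
    by rewrite -(pmulr_rge0 _ CP); apply: le_trans h.
  apply: (@le_trans _ _ (1 * (C * p * Ient p x) * L)).
    rewrite ler_wpM2r ?(ltW Lp) //; apply: ler_pM => //; lra.
  have -> : 1 * (C * p * Ient p x) * L = C * p * L * Ient p x by ring.
  by rewrite -[leRHS]mul1r ler_wpM2r.
have x0' : 0 < x by apply: le_lt_trans far; rewrite mulr_ge0 ?sqr_ge0 ?ltW.
have lnx : ln (x / p) = ln x + L.
  by rewrite lnM ?posrE ?invr_gt0.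
suff key : (1 - eps) * x * L <= ln x + L - 1.
  apply: le_trans (Ient_ge_poisson p01 x01); rewrite lnx.
  have h1 : (x - p) ^+ 2 <= x ^+ 2.
    have px : p <= x.
      apply: le_trans (ltW far); rewrite ler_peMl ?(ltW p0) //.
      by rewrite exprn_ege1 // -[leLHS]expR0 ler_expR.
    rewrite ler_sqr ?nnegrE; lra.
  apply: (@le_trans _ _ (x * ((1 - eps) * x * L))).
    have -> : x * ((1 - eps) * x * L) = (1 - eps) * L * x ^+ 2 by ring.
    have -> : (1 - eps) * (x - p) ^+ 2 * L = (1 - eps) * L * (x - p) ^+ 2 by ring.
    by rewrite ler_wpM2l // mulr_ge0 ?ltW // subr_gt0.
  apply: le_trans (ler_wpM2l x0 key) _; lra.
have xL : x * L <= L by rewrite ler_piMl // ltW.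
have [big|small] := leP (- (eps * L) + 1) (ln x).
  have : (1 - eps) * (x * L) <= (1 - eps) * L by rewrite ler_wpM2l //; lra.
  lra.
have lnge : 2 <= ln x + L.
  rewrite -lnx -(expRK 2) ler_ln ?posrE ?expR_gt0 ?divr_gt0 //.
  rewrite ler_pdivlMr //; apply: le_trans (ltW far).
  by rewrite (_ : 2 = 1 + 1) // expRD -expr2.
have xsmall : x <= c * expR (- (eps * L)).
  by rewrite -expRD -[leLHS](lnK x0') ler_expR; lra.
have xL1 : x * L <= 1.
  apply: (@le_trans _ _ (c * (L * expR (- (eps * L))))).
    by rewrite mulrCA mulrC ler_wpM2l // ltW.
  apply: le_trans (ler_wpM2l (ltW c0) (mul_expRN_le e0 Lp)) _.
  rewrite mulrA ler_pdivrMr ?mulr_gt0 ?exprn_gt0 // mul1r.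
  have : 4 * c / eps ^+ 2 <= L by lra.
  by rewrite ler_pdivrMr ?exprn_gt0 //; lra.
have xL0 : 0 <= x * L by rewrite mulr_ge0 // ltW.
have : (1 - eps) * (x * L) <= 1 * (x * L) by rewrite ler_wpM2r //; lra.
lra.
Qed.

End Entropy.

(** * Splitting a number into parts of size at most 1 *)

Section ConcavePower.
Variables (R : realType) (al : R).
Hypothesis al01 : 0 < al <= 1.
Implicit Types u w t s z f : R.

Let al0 : 0 < al. Proof. by case/andP: al01. Qed.
Let al1 : al <= 1. Proof. by case/andP: al01. Qed.

Lemma powR_bernoulli u : 0 <= u -> u `^ al <= 1 + al * (u - 1).
Proof.
rewrite le_eqVlt => /orP[/eqP <-|u0].
  by rewrite powR0 ?gt_eqF //; have := al1; lra.
have [A AE] : exists A, A = 1 + al * (u - 1) by exists (1 + al * (u - 1)).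
have A0 : 0 < A.
  have -> : A = (1 - al) + al * u by rewrite AE; ring.
  by rewrite ltr_wpDl ?mulr_gt0 // subr_ge0.
rewrite -AE /powR gt_eqF // -[leRHS]lnK ?posrE // ler_expR.
have h1 : al * ln (u / A) <= al * (u / A - 1).
  by rewrite ler_pM2l //; apply: ln_le_sub1; rewrite divr_gt0.
have h2 : (1 - al) * ln (A^-1) <= (1 - al) * (A^-1 - 1).
  apply: ler_wpM2l; first by rewrite subr_ge0.
  by apply: ln_le_sub1; rewrite invr_gt0.
have E : al * (u / A - 1) + (1 - al) * (A^-1 - 1) = 0.
  have -> : al * (u / A - 1) + (1 - al) * (A^-1 - 1) = ((1 - al) + al * u) / A - 1.
    by field; rewrite gt_eqF.
  by rewrite (_ : 1 - al + al * u = A) ?divff ?gt_eqF ?subrr // AE; ring.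
rewrite ln_div ?posrE // in h1; rewrite lnV ?posrE // in h2; lra.
Qed.

Lemma powR_subadd s z : 0 <= s -> 0 <= z -> (s + z) `^ al <= s `^ al + z `^ al.
Proof.
rewrite le_eqVlt => /orP[/eqP <-|s0] z0.
  by rewrite add0r lerDr powR_ge0.
have sz0 : 0 < s + z by lra.
have part a : 0 <= a -> a <= s + z -> a / (s + z) * (s + z) `^ al <= a `^ al.
  rewrite le_eqVlt => /orP[/eqP <-|a0] asz; first by rewrite !mul0r powR_ge0.
  have := @ger1_powR _ (a / (s + z)) al; rewrite divr_gt0 //= ler_pdivrMr // mul1r.
  move=> /(_ asz al1) h; rewrite -(ler_pM2r (powR_gt0 al sz0)) in h.
  by apply: le_trans h _; rewrite -powRM ?divr_ge0 ?(ltW a0) ?(ltW sz0) // divfK ?gt_eqF.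
apply: le_trans (lerD (part s _ _) (part z _ _)); try lra.
by rewrite -mulrDl -mulrDl divff ?gt_eqF // mul1r.
Qed.

(** Bernoulli's inequality at w and at 1, both relative to their mean m. *)
Lemma powR_concave1 w t : 0 <= w -> 0 <= t <= 1 ->
  (1 - t) * w `^ al + t <= ((1 - t) * w + t) `^ al.
Proof.
move=> w0 /andP[t0 t1].
have [m mE] : exists m, m = (1 - t) * w + t by exists ((1 - t) * w + t).
rewrite -mE.
have [m0|mN] := ltP 0 m; last first.
  have tw0 : 0 <= (1 - t) * w by rewrite mulr_ge0 ?subr_ge0.
  have te : t = 0 by rewrite mE in mN; lra.
  have we : w = 0 by rewrite mE te in mN; lra.
  by rewrite mE te we !(powR0, mulr0, add0r) ?gt_eqF.
have bern u : 0 <= u -> u `^ al <= m `^ al * (1 + al * (u / m - 1)).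
  move=> u0; have := powR_bernoulli (divr_ge0 u0 (ltW m0)).
  rewrite -(ler_pM2l (powR_gt0 al m0)) -powRM ?(ltW m0) ?divr_ge0 ?(ltW m0) //.
  by rewrite mulrC divfK ?gt_eqF.
have h1 : (1 - t) * w `^ al <= (1 - t) * (m `^ al * (1 + al * (w / m - 1))).
  by rewrite ler_wpM2l ?bern // subr_ge0.
have h2 : t * 1 `^ al <= t * (m `^ al * (1 + al * (1 / m - 1))).
  by rewrite ler_wpM2l ?bern.
rewrite powR1 mulr1 in h2; apply: le_trans (lerD h1 h2) _.
rewrite le_eqVlt; apply/orP; left; apply/eqP.
have -> : (1 - t) * (m `^ al * (1 + al * (w / m - 1))) +
    t * (m `^ al * (1 + al * (1 / m - 1))) =
    m `^ al * (1 + al * (((1 - t) * w + t) / m - 1)).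
  by field; rewrite gt_eqF.
by rewrite -mE divff ?gt_eqF // subrr mulr0 addr0 mulr1.
Qed.

(** The least value of the sum of z_j^al over all ways to write s as a sum of
    numbers z_j in [0, 1]. *)
Definition stair s : R := intpart s + fracpart s `^ al.

Lemma fracpart_itv s : 0 <= fracpart s < 1.
Proof.
rewrite /fracpart /intpart subr_ge0 floor_le ltrBlDl.
by have := floorD1_gt s; rewrite intrD.
Qed.

Lemma intpart_shift s (m : int) f : s = m%:~R + f -> 0 <= f < 1 ->
  intpart s = m%:~R /\ fracpart s = f.
Proof.
move=> sE /andP[f0 f1]; have fl : Num.floor s = m.
  by apply: floor_def; rewrite intrD sE lerDl f0 ltrD2l.
by rewrite /fracpart /intpart fl; split => //; rewrite sE; ring.
Qed.

(** Since z |-> z^al is concave, two fractional parts adding up to more than 1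
    cost at least as much as one unit and the excess. *)
Lemma stair_subadd s z : 0 <= z <= 1 -> stair (s + z) <= stair s + z `^ al.
Proof.
move=> /andP[z0 z1]; have /andP[f0 f1] := fracpart_itv s.
have sE : s = (Num.floor s)%:~R + fracpart s by rewrite /fracpart /intpart; ring.
have [f fE] : exists f, f = fracpart s by exists (fracpart s).
rewrite -fE in f0 f1 sE.
have [fz|fz] := ltP (f + z) 1.
  have [||h1 h2] := @intpart_shift (s + z) (Num.floor s) (f + z).
  - by rewrite {1}sE addrA.
  - by rewrite fz andbT addr_ge0.
  - by rewrite /stair h1 h2 -fE -addrA lerD2l powR_subadd.
have [||h1 h2] := @intpart_shift (s + z) (Num.floor s + 1) (f + z - 1).
- by rewrite {1}sE intrD; ring.
- by apply/andP; split; lra.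
have [w wE] : exists w, w = f + z - 1 by exists (f + z - 1).
rewrite /stair h1 h2 -fE intrD -/(intpart s) -wE -!addrA lerD2l.
have w1 : 0 < 1 - w by rewrite wE; lra.
have w0 : 0 <= w by rewrite wE; lra.
have conc a : w <= a <= 1 -> (1 - a) / (1 - w) * w `^ al + (a - w) / (1 - w) <= a `^ al.
  move=> /andP[wa a1].
  have t01 : 0 <= (a - w) / (1 - w) <= 1.
    apply/andP; split; first by apply: divr_ge0; lra.
    by rewrite ler_pdivrMr // mul1r; lra.
  have := powR_concave1 w0 t01.
  have -> : 1 - (a - w) / (1 - w) = (1 - a) / (1 - w) by field; rewrite gt_eqF.
  suff -> : (1 - a) / (1 - w) * w + (a - w) / (1 - w) = a by [].
  by field; rewrite gt_eqF.
apply: le_trans (lerD (conc f _) (conc z _)); last 2 first.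
- by rewrite wE; apply/andP; split; lra.
- by rewrite wE; apply/andP; split; lra.
rewrite le_eqVlt; apply/orP; left; apply/eqP.
have zE : z = w + 1 - f by rewrite wE; ring.
by rewrite zE; field; rewrite gt_eqF.
Qed.

Lemma stair0 : stair 0 = 0.
Proof.
have [||h1 h2] := @intpart_shift 0 0 0; rewrite ?addr0 ?lexx ?ltr01 //.
by rewrite /stair h1 h2 add0r powR0 // gt_eqF.
Qed.

Lemma stair_mono s z : s <= z -> stair s <= stair z.
Proof.
move=> sz; have /andP[s0 s1] := fracpart_itv s; have /andP[z0 z1] := fracpart_itv z.
have := le_floor sz; rewrite le_eqVlt => /orP[/eqP fE|].
  rewrite /stair /intpart fE lerD2l; apply: ge0_ler_powR; rewrite ?nnegrE ?(ltW al0) //.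
  by rewrite /fracpart /intpart fE lerD2r.
rewrite -lezD1 -(ler_int R) intrD => h.
apply: (@le_trans _ _ (intpart s + 1)).
  have one : 1 = 1 `^ al :> R by rewrite powR1.
  rewrite lerD2l one; apply: ge0_ler_powR; rewrite ?nnegrE ?(ltW al0) //.
  exact: ltW.
by apply: le_trans h _; rewrite lerDl powR_ge0.
Qed.

Lemma stair_sum (J : Type) (r : seq J) (P : pred J) (y : J -> R) s :
  (forall j, P j -> 0 <= y j <= 1) -> s <= \sum_(j <- r | P j) y j ->
  stair s <= \sum_(j <- r | P j) y j `^ al.
Proof.
move=> y01 /stair_mono /le_trans; apply.
elim: r => [|j r IH]; first by rewrite !big_nil stair0.
rewrite !big_cons; case: ifP => // Pj.
rewrite addrC [leRHS]addrC; apply: le_trans (stair_subadd _ (y01 _ Pj)) _.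
by rewrite lerD2r.
Qed.

End ConcavePower.

(** * Spectral decomposition of real symmetric matrices *)

Section RealSpectral.
Variables (R : realType) (n : nat).
Implicit Types A : 'M[R]_n.

(** The eigenvalues of the complexified matrix are real, hence have real
    eigenvectors. *)
Lemma sym_eigenvalue A : A^T = A -> A != 0 -> exists2 l, l != 0 & eigenvalue A l.
Proof.
move=> Asym An0; pose toC := real_complex R.
pose AC : 'M[R[i]]_n := map_mx toC A.
have ACherm : AC \is hermsymmx.
  apply: realsym_hermsym.
    apply/is_hermitianmxP; rewrite expr0 scale1r -map_trmx.
    by apply/matrixP => i j; rewrite !mxE -[in LHS]Asym mxE.
  by apply/mxOverP => i j; rewrite mxE; apply/complex_realP; exists (A i j).
have dreal := hermitian_spectral_diag_real ACherm.
have /orthomx_spectralP := hermitian_normalmx ACherm.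
have := spectral_unit AC; set P := spectralmx AC; set d := spectral_diag AC in dreal *.
move=> Pu ACE.
have [d0|dn0] := eqVneq d 0.
  case/eqP: An0; apply/matrixP=> i j; rewrite mxE; apply: (@complexI R).
  have : AC = 0.
    rewrite ACE d0 (_ : diag_mx 0 = 0) ?mulmx0 ?mul0mx //.
    by apply/matrixP => ? ?; rewrite !mxE mul0rn.
  by move/matrixP/(_ i j); rewrite !mxE.
have [k dk] : exists k, d 0 k != 0 by apply/rV0Pn.
have /complex_realP[l lE] : d 0 k \is Num.real by apply: (mxOverP dreal).
exists l; first by apply: contra_neq dk => l0; rewrite lE l0.
rewrite -(eigenvalue_map toC) -/AC; apply/eigenvalueP; exists (row k P).
  have PAC : P *m AC = diag_mx d *m P.
    by rewrite {1}ACE !mulmxA mulmxV // mul1mx.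
  by rewrite -row_mul PAC; apply/rowP => j; rewrite mul_diag_mx !mxE lE.
apply/eqP => Pk0; have := row_free_unit P; rewrite Pu => /row_freeP[Q PQ].
have : row k (P *m Q) = 0 by rewrite row_mul Pk0 mul0mx.
by rewrite PQ => /rowP/(_ k); rewrite !mxE eqxx => /eqP; rewrite oner_eq0.
Qed.

Lemma sym_unit_eigenvector A : A^T = A -> A != 0 ->
  exists l (u : 'rV[R]_n), [/\ l != 0, u *m A = l *: u & u *m u^T = 1].
Proof.
move=> As An0; have [l ln0 /eigenvalueP[v vA vn0]] := sym_eigenvalue As An0.
pose s := (v *m v^T) 0 0.
have s0 : 0 < s.
  rewrite /s mxE lt_neqAle; apply/andP; split; last first.
    by apply: sumr_ge0 => i _; rewrite mxE -expr2 sqr_ge0.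
  rewrite eq_sym psumr_neq0 => [|i _]; last by rewrite mxE -expr2 sqr_ge0.
  have [i vi] : exists i, v 0 i != 0 by apply/rV0Pn.
  apply/hasP; exists i; rewrite ?mem_index_enum //=.
  by rewrite mxE -expr2 lt_neqAle sqr_ge0 andbT eq_sym sqrf_eq0.
exists l, ((Num.sqrt s)^-1 *: v); split => //.
  by rewrite -scalemxAl vA !scalerA mulrC.
rewrite linearZ /= -scalemxAl -scalemxAr scalerA [v *m v^T]mx11_scalar -/s.
rewrite scale_scalar_mx -invfM -expr2 sqr_sqrtr ?ltW // mulVf ?gt_eqF //.
Qed.

(** Deflation: subtracting the component along a unit eigenvector lowers the
    rank, and the remaining eigenvectors are automatically orthogonal to it. *)
Lemma sym_decomp A : A^T = A ->
  exists m (l : 'rV[R]_m) (U : 'M[R]_(m, n)),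
    [/\ forall i, l 0 i != 0, U *m U^T = 1%:M & A = U^T *m diag_mx l *m U].
Proof.
have [k] := ubnP (\rank A); elim: k A => // k IH A; rewrite ltnS => rk As.
have [->|An0] := eqVneq A 0.
  exists 0%N, 0, 0; split; first by case.
    by apply/matrixP; case.
  by rewrite mulmx0.
have [l [u [ln0 uA uu]]] := sym_unit_eigenvector As An0.
have Au : A *m u^T = l *: u^T by rewrite -{1}As -trmx_mul uA linearZ.
pose B := A - l *: (u^T *m u).
have Bs : B^T = B.
  by rewrite /B linearB linearZ /= trmx_mul trmxK As.
have uB : u *m B = 0.
  by rewrite /B mulmxBr uA -scalemxAr mulmxA uu mul1mx subrr.
have Bu : B *m u^T = 0 by rewrite -{1}Bs -trmx_mul uB trmx0.
have rB : (\rank B < \rank A)%N.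
  have : (kermx A < kermx B)%MS.
    rewrite ltmxE; apply/andP; split.
      apply/sub_kermxP; rewrite /B mulmxBr mulmx_ker sub0r -scalemxAr mulmxA.
      have -> : kermx A *m u^T = 0.
        have -> : u^T = l^-1 *: (A *m u^T) by rewrite Au scalerA mulVf // scale1r.
        by rewrite -scalemxAr mulmxA mulmx_ker mul0mx scaler0.
      by rewrite mul0mx scaler0 oppr0.
    apply/negP => /(submx_trans (_ : (u <= kermx B)%MS)).
    have -> : (u <= kermx B)%MS by apply/sub_kermxP.
    move=> /(_ isT)/sub_kermxP; rewrite uA => /eqP; rewrite scaler_eq0 (negPf ln0) /=.
    move=> /eqP u0; move: uu; rewrite u0 mul0mx => /matrixP/(_ 0 0)/eqP.
    by rewrite !mxE eq_sym oner_eq0.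
  move/rank_ltmx; rewrite !mxrank_ker ltn_sub2lE //; exact: rank_leq_row.
have [m [l' [U [l'n0 UU BE]]]] := IH B (leq_trans rB rk) Bs.
have Uu : U *m u^T = 0.
  have : diag_mx l' *m (U *m u^T) = 0.
    transitivity (U *m (B *m u^T)); last by rewrite Bu mulmx0.
    by rewrite BE !mulmxA UU mul1mx.
  move=> /matrixP D; apply/matrixP => i j; have := D i j.
  rewrite mul_diag_mx !mxE => /eqP; rewrite mulf_eq0 (negPf (l'n0 i)) /=.
  by move/eqP.
exists (1 + m)%N, (row_mx (const_mx l) l'), (col_mx u U); split.
- move=> i; rewrite mxE; case: splitP => j _; last exact: l'n0.
  by rewrite mxE.
- rewrite tr_col_mx mul_col_row uu Uu UU scalar_mx_block.
  by rewrite -[u *m U^T]trmxK trmx_mul trmxK Uu trmx0.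
- rewrite tr_col_mx diag_mx_row mul_row_block !mulmx0 addr0 add0r mul_row_col.
  rewrite -BE /B (_ : diag_mx (const_mx l) = l%:M).
    by rewrite mul_mx_scalar -scalemxAl addrC subrK.
  by rewrite diag_const_mx.
Qed.

Lemma sym_spectral (a : 'I_n -> 'I_n -> R) : (forall i j, a i j = a j i) ->
  exists m (l : 'I_m -> R) (u : 'I_m -> 'I_n -> R),
    [/\ forall i, l i != 0,
        forall i j, \sum_x u i x * u j x = (i == j)%:R &
        forall x y, a x y = \sum_i l i * u i x * u i y].
Proof.
move=> asym; pose A : 'M[R]_n := \matrix_(i, j) a i j.
have As : A^T = A by apply/matrixP => i j; rewrite !mxE asym.
have [m [l [U [ln0 /matrixP UU /matrixP AE]]]] := sym_decomp As.
exists m, (l 0), U; split=> // [i j|x y].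
  have := UU i j; rewrite !mxE => <-; apply: eq_bigr => k _; by rewrite !mxE.
have := AE x y; rewrite !mxE => ->; apply: eq_bigr => k _.
by rewrite mul_mx_diag !mxE [l 0 k * _]mulrC.
Qed.

End RealSpectral.

(** * The extremal problem for regular H *)

Section TwoRegular.
Variables (R : realType) (H : sgraph) (n : nat).
Hypothesis n0 : (0 < n)%N.
Hypothesis H_conn : gconnected H.
Local Notation V := 'I_(nv H).
Local Notation ET := {e : V * V | e \in edges H}.

Lemma edge_label_const (T : eqType) (psi : ET -> T) (e0 : ET) :
  (forall (x : V) (e e' : ET), incident x (val e) -> incident x (val e') ->
     psi e = psi e') ->
  forall e, psi e = psi e0.
Proof.
move=> loc e.
have all (x : V) : [forall e' : ET, incident x (val e') ==> (psi e' == psi e0)].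
  apply: (@connected_ind _ H_conn
    (fun x => [forall e' : ET, incident x (val e') ==> (psi e' == psi e0)])
    (val e0).1).
    apply/forallP => e'; apply/implyP => inc; apply/eqP.
    by apply: (loc (val e0).1) => //; rewrite /incident eqxx.
  move=> y z /edge_exists[e1 [e1E ye ze]] /forallP h.
  apply/forallP => e'; apply/implyP => inc; apply/eqP.
  rewrite (loc z e' (Sub e1 e1E)) //; apply/eqP.
  by have := h (Sub e1 e1E); rewrite SubK ye.
apply/eqP; move/forallP: (all (val e).1) => /(_ e).
by rewrite /incident eqxx.
Qed.

Lemma prod_edges_vertices (w : ET -> V -> R) :
  \prod_(e : ET) (w e (val e).1 * w e (val e).2) =
  \prod_(x : V) \prod_(e : ET | incident x (val e)) w e x.
Proof.
rewrite (exchange_big_dep xpredT) //=; apply: eq_bigr => e _.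
have e12 : (val e).1 != (val e).2.
  by apply: (edge_neq (fintype.subxx (edges H)) (valP e)).
rewrite (bigD1 (val e).1) /=; last by rewrite /incident eqxx.
rewrite (bigD1 (val e).2) /=; last by rewrite /incident eqxx orbT eq_sym e12.
rewrite big1 ?mulr1 // => x /andP[/andP[/orP[/eqP <-|/eqP <-]]]; by rewrite eqxx.
Qed.

Lemma card_star_sub (x : V) : #|[set e : ET | incident x (val e)]| = deg x.
Proof.
rewrite -card_star_edges -(card_imset _ val_inj); apply: eq_card => e.
apply/imsetP/idP => [[e' + ->]|]; rewrite !inE.
  by move=> ->; rewrite andbT; have := valP e'; rewrite inE.
move=> /andP[eE inc]; have eE' : e \in edges H by rewrite inE.
by exists (Sub e eE'); rewrite ?inE.
Qed.

(** Expanding a in an orthonormal eigenbasis and summing over the position of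
    each vertex forces the two edges at a vertex to carry the same eigenvector;
    by connectivity only constant labellings survive.  For a cycle this is the
    trace formula. *)
Lemma tdens_two_regular (m : nat) (l : 'I_m -> R) (u : 'I_m -> 'I_n -> R)
    (a : 'I_n -> 'I_n -> R) :
  (0 < #|edges H|)%N -> (forall x : V, deg x = 2%N) ->
  (forall i j, \sum_x u i x * u j x = (i == j)%:R) ->
  (forall x y, a x y = \sum_i l i * u i x * u i y) ->
  tdens (edges H) (fun=> a) = n%:R ^- nv H * \sum_i l i ^+ ne H.
Proof.
move=> E0 deg2 ortho aE; rewrite /tdens /avg !card_ord; congr (_ * _).
pose ok (psi : {ffun ET -> 'I_m}) (x : V) : R :=
  \sum_a \prod_(e : ET | incident x (val e)) u (psi e) a.
have okE (psi : {ffun ET -> 'I_m}) (x : V) (e e' : ET) : incident x (val e) -> incident x (val e') ->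
    psi e != psi e' -> ok psi x = 0.
  move=> ie ie' pe; have ee' : e != e' by apply: contraNneq pe => ->.
  have se : [set e : ET | incident x (val e)] = [set e; e'].
    apply/esym/eqP; rewrite eqEcard card_star_sub deg2 cards2 ee' andbT.
    by apply/fintype.subsetP => f; rewrite !inE => /orP[] /eqP ->.
  have := ortho (psi e) (psi e'); rewrite (negPf pe) mulr0n => <-.
  apply: eq_bigr => b _.
  rewrite (eq_bigl (mem [set e; e'])) => [|f]; last by rewrite -se !inE.
  by rewrite big_setU1 ?inE //= big_set1.
have ok1 (i : 'I_m) (x : V) : ok [ffun=> i] x = 1.
  have : #|[set e : ET | incident x (val e)]| == 2%N by rewrite card_star_sub deg2.
  move=> /cards2P[e [e' [ee' se]]].
  have := ortho i i; rewrite eqxx mulr1n => <-; apply: eq_bigr => b _.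
  rewrite (eq_bigl (mem [set e; e'])) => [|f]; last by rewrite -se !inE.
  by rewrite big_setU1 ?inE //= big_set1 !ffunE.
have prodE (T : V * V -> R) : \prod_(e in edges H) T e = \prod_(e : ET) T (val e).
  exact: big_sub.
transitivity (\sum_(psi : {ffun ET -> 'I_m})
    (\prod_(e : ET) l (psi e)) * \prod_(x : V) ok psi x).
  transitivity (\sum_(phi : {ffun V -> 'I_n}) \sum_(psi : {ffun ET -> 'I_m})
    \prod_(e : ET) (l (psi e) * u (psi e) (phi (val e).1) * u (psi e) (phi (val e).2))).
    apply: eq_bigr => phi _; rewrite prodE.
    under eq_bigr do rewrite aE.
    by rewrite bigA_distr_bigA.
  rewrite exchange_big; apply: eq_bigr => psi _ /=.
  rewrite [X in _ = _ * X](bigA_distr_bigA (fun x b =>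
    \prod_(e : ET | incident x (val e)) u (psi e) b)) mulr_sumr.
  apply: eq_bigr => phi _.
  rewrite -(prod_edges_vertices (fun e x => u (psi e) (phi x))) -big_split /=.
  by apply: eq_bigr => e _; rewrite mulrA.
move: (E0); rewrite card_gt0 => /finset.set0Pn[e0' e0E].
pose e0 : ET := Sub e0' e0E.
rewrite (partition_big (fun psi : {ffun ET -> 'I_m} => psi e0) xpredT) //=.
apply: eq_bigr => i _.
rewrite (bigD1 [ffun=> i]) /=; last by rewrite ffunE.
rewrite [X in _ + X]big1 ?addr0 => [|psi /andP[/eqP pi pn]].
  rewrite [X in _ * X]big1 ?mulr1 => [|x _]; last exact: ok1.
  transitivity (\prod_(e in edges H) l i); last by rewrite prodr_const.
  by rewrite prodE; apply: eq_bigr => e _; rewrite ffunE.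
suff [x okx] : exists x, ok psi x = 0 by rewrite (bigD1 x) //= okx mul0r mulr0.
apply: contrapT => nok; move/eqP: pn; apply; apply/ffunP => e.
rewrite ffunE -pi; apply: edge_label_const => x f f' xf xf'.
by apply/eqP; apply: contraT => ff'; case: nok; exists x; apply: okE ff'.
Qed.

End TwoRegular.

Section Extremal.
Variables (R : realType) (H : sgraph) (n : nat).
Hypothesis n0 : (0 < n)%N.
Hypothesis H_conn : gconnected H.
Local Notation V := 'I_(nv H).

(** An eigenvector of U for a nonzero eigenvalue is orthogonal to the constants,
    hence is an eigenvector of the nonnegative matrix X = p + U with row sums
    p * n; compare entries where it is maximal in modulus. *)
Lemma eigenvalue_le_rowsum (a X : 'I_n -> 'I_n -> R) (p l : R) (u : 'I_n -> R) :
  (forall i j, X i j = p + a i j) -> (forall i j, 0 <= X i j) ->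
  (forall j, \sum_i a i j = 0) -> (forall i, \sum_j a i j = 0) ->
  l != 0 -> (forall x, \sum_y a x y * u y = l * u x) -> \sum_x u x * u x = 1 ->
  `|l| <= p * n%:R.
Proof.
move=> XE X0 a0 a0' ln0 ev u1.
have su : \sum_x u x = 0.
  have : l * \sum_x u x = 0.
    rewrite mulr_sumr; under eq_bigr do rewrite -ev.
    rewrite exchange_big /= big1 // => y _.
    by rewrite -mulr_suml a0 mul0r.
  by move=> /eqP; rewrite mulf_eq0 (negPf ln0) => /eqP.
have [x _ xmax] := @arg_maxP _ R _ (Ordinal n0) xpredT (fun x => `|u x|) isT.
have {}xmax y : `|u y| <= `|u x| by exact: xmax.
have ux0 : 0 < `|u x|.
  rewrite normr_gt0; apply/eqP => ux; move: u1; rewrite big1 => [/eqP|y _].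
    by rewrite eq_sym oner_eq0.
  have := xmax y; rewrite ux normr0 normr_le0 => /eqP ->.
  by rewrite mul0r.
rewrite -(ler_pM2r ux0) -normrM -ev.
have -> : \sum_y a x y * u y = \sum_y X x y * u y.
  under [RHS]eq_bigr do rewrite XE mulrDl.
  by rewrite big_split /= -mulr_sumr su mulr0 add0r.
apply: le_trans (ler_norm_sum _ _ _) _.
apply: (@le_trans _ _ (\sum_y X x y * `|u x|)).
  apply: ler_sum => y _; rewrite normrM ger0_norm ?X0 //.
  by apply: ler_wpM2l; [exact: X0|exact: xmax].
rewrite -mulr_suml; under eq_bigr do rewrite XE.
by rewrite big_split /= a0' addr0 sumr_const card_ord mulr_natr.
Qed.

Lemma handshake (D : nat) : (forall x : V, deg x = D) -> (ne H * 2 = nv H * D)%N.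
Proof.
move=> degD.
transitivity (\sum_(x : V) #|star (edges H) x|)%N; last first.
  rewrite (eq_bigr (fun=> D)) => [|x _]; last by rewrite card_star_edges.
  by rewrite sum_nat_const card_ord.
under eq_bigr do rewrite -sum1_card.
rewrite (exchange_big_dep (mem (edges H))) /= => [|x e _]; last first.
  by rewrite inE => /andP[].
rewrite -sum_nat_const; apply: eq_bigr => e eE.
rewrite (eq_bigl (mem [set e.1; e.2])) => [|x]; last first.
  by rewrite !inE; move: eE; rewrite inE => -> /=; rewrite /incident ![_ == x]eq_sym.
by rewrite sum1_card cards2 (edge_neq (fintype.subxx _) eE).
Qed.

(** For D = 2 the eigenvalues of U / n cannot exceed p, so that a large density
    needs several of them, whence the staircase. *)
Definition cost (D : nat) (s : R) : R :=
  if D == 2%N then stair (2 / (nv H)%:R) s else s `^ (2 / (nv H)%:R).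

(** For D >= 3 this is Finner's inequality with |U|^D <= U^2.  For D = 2 put
    y i = (|l i| / (p n))^v for the eigenvalues l i of U: these numbers lie in
    [0, 1] and sum to at least s, while the y i^(2/v) sum to the average of
    U^2 divided by p^2. *)
Lemma tdens_extremal (X : 'M[R]_n) (U : 'I_n -> 'I_n -> R) (D : nat) (p s : R) :
  (2 <= D)%N -> (0 < ne H)%N -> (forall x : V, deg x = D) -> 0 < p -> 0 <= s ->
  (forall i j, X i j = p + U i j) -> (forall i j, 0 <= X i j) ->
  (forall i j, U i j = U j i) -> (forall i, \sum_j U i j = 0) ->
  (forall i j, `|U i j| <= 1) ->
  s * p ^+ ne H <= tdens (edges H) (fun=> U) ->
  cost D s * p ^+ D <= avg2 (fun i j => U i j ^+ 2).
Proof.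
move=> D2 E0 degD p0 s0 XU X0 Usym U0 U1 st.
have hs := handshake degD.
have D0 : (0 < D)%N by apply: leq_trans D2.
have v0 : (0 < nv H)%N by case: H_conn.
have v0R : (0 : R) < (nv H)%:R by rewrite ltr0n.
have S0 : 0 <= avg2 (fun i j => U i j ^+ 2) by apply: avg2_ge0 => i j; apply: sqr_ge0.
rewrite /cost; case: eqP => [D2E|_]; last first.
  set S := avg2 _ in S0 *; set v : R := (nv H)%:R in v0R *.
  have tS : tdens (edges H) (fun=> U) <= S `^ (v / 2).
    apply: le_trans (ler_norm _) _; apply: le_trans (norm_tdens_le _ _) _.
    apply: le_trans (tdens_finner n0 D0 (fintype.subxx _) _ _) _ => //.
      by move=> x; rewrite degD.
    rewrite prodr_const -powR_mulrn ?powR_ge0 // -powRrM.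
    have -> : D%:R^-1 * (#|edges H|)%:R = v / 2 :> R.
      apply: (mulfI (_ : D%:R != 0 :> R)); first by rewrite pnatr_eq0 -lt0n.
      rewrite mulrA mulfV ?pnatr_eq0 -?lt0n // mul1r.
      have := congr1 (fun k => k%:R : R) hs; rewrite !natrM -/v /ne => h; lra.
    apply: ge0_ler_powR; rewrite ?nnegrE ?divr_ge0 ?(ltW v0R) //.
      by apply: avg2_ge0 => i j; rewrite exprn_ge0.
    by apply: ler_avg2 => i j; apply: expr_le_sqr.
  have v20 : v / 2 != 0 by rewrite gt_eqF // divr_gt0.
  have h : (s * p ^+ ne H) `^ (2 / v) <= (S `^ (v / 2)) `^ (2 / v).
    apply: ge0_ler_powR; rewrite ?nnegrE ?divr_ge0 ?powR_ge0 ?(ltW v0R) //; last first.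
      exact: le_trans st tS.
    by rewrite mulr_ge0 ?exprn_ge0 ?(ltW p0).
  move: h; rewrite -powRrM (_ : v / 2 * (2 / v) = 1); last by field; rewrite gt_eqF.
  rewrite powRr1 // powRM ?exprn_ge0 ?(ltW p0) //.
  rewrite -(powR_mulrn (ne H) (ltW p0)) -powRrM (_ : _ * (2 / v) = D%:R) ?powR_mulrn ?(ltW p0) //.
  have := congr1 (fun k => k%:R : R) hs; rewrite !natrM -/v => h.
  by rewrite mulrA h mulrAC mulfV ?mul1r // gt_eqF.
move: degD hs; rewrite D2E => deg2 hs.
have eE : ne H = nv H by lia.
have [m [l [u [ln0 ortho UE]]]] := sym_spectral Usym.
have tE := tdens_two_regular H_conn E0 deg2 ortho UE.
have ev i x : \sum_y U x y * u i y = l i * u i x.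
  under eq_bigr do rewrite UE mulr_suml.
  rewrite exchange_big /= (bigD1 i) //= [X in _ + X]big1 ?addr0 => [|j ji].
    under eq_bigr do rewrite -mulrA.
    by rewrite -mulr_sumr ortho eqxx mulr1.
  under eq_bigr do rewrite -mulrA.
  by rewrite -mulr_sumr ortho (negPf ji) mulr0.
have Ucol j : \sum_i U i j = 0 by under eq_bigr do rewrite Usym; exact: U0.
have lle i : `|l i| <= p * n%:R.
  apply: (eigenvalue_le_rowsum XU X0 Ucol U0 (ln0 i) (ev i)).
  by rewrite ortho eqxx.
have n0R : (0 : R) < n%:R by rewrite ltr0n.
have pn0 : 0 < p * n%:R by rewrite mulr_gt0.
have S2 : \sum_i l i ^+ 2 = n%:R ^+ 2 * avg2 (fun i j => U i j ^+ 2).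
  transitivity (\sum_x \sum_y U x y ^+ 2); last first.
    rewrite /avg2 /avgT !card_ord -mulr_sumr; field.
    by rewrite gt_eqF.
  symmetry.
  transitivity (\sum_x \sum_y \sum_i l i * u i x * (U x y * u i y)).
    apply: eq_bigr => x _; apply: eq_bigr => y _.
    rewrite expr2 {1}UE mulr_suml; apply: eq_bigr => i _.
    by rewrite -!mulrA [u i y * _]mulrC.
  under eq_bigr do rewrite exchange_big /=.
  rewrite exchange_big /=; apply: eq_bigr => i _.
  under eq_bigr do rewrite -mulr_sumr ev.
  rewrite (eq_bigr (fun x => l i ^+ 2 * (u i x * u i x))) => [|x _]; last by ring.
  by rewrite -mulr_sumr ortho eqxx mulr1.
pose y i := (`|l i| / (p * n%:R)) ^+ nv H.
have q01 i : 0 <= `|l i| / (p * n%:R) <= 1.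
  by rewrite divr_ge0 ?(ltW pn0) //= ler_pdivrMr // mul1r.
pose al : R := 2 / (nv H)%:R.
have al01 : 0 < al <= 1.
  apply/andP; split; first exact: divr_gt0.
  rewrite ler_pdivrMr // mul1r ler_nat.
  have := deg2 (Ordinal v0) => d2.
  by rewrite -d2 degE; apply: leq_trans (max_card _) _; rewrite card_ord.
have ys : s <= \sum_i y i.
  rewrite -(ler_pM2r (exprn_gt0 (ne H) p0)); apply: le_trans st _.
  rewrite tE mulr_suml mulr_sumr; apply: ler_sum => i _.
  rewrite /y eE expr_div_n exprMn.
  have -> : `|l i| ^+ nv H / (p ^+ nv H * n%:R ^+ nv H) * p ^+ nv H =
            n%:R ^- nv H * `|l i| ^+ nv H.
    by field; rewrite !expf_neq0 ?gt_eqF.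
  apply: ler_wpM2l; first by rewrite invr_ge0 exprn_ge0.
  by rewrite -normrX ler_norm.
have := stair_sum al01 (P := xpredT) (r := index_enum _) (y := y) (s := s) _ ys.
have y01 i : true -> 0 <= y i <= 1.
  by move=> _; have /andP[q0 q1] := q01 i; rewrite exprn_ge0 //= exprn_ile1.
move=> /(_ y01) h.
have yE i : y i `^ (2 / (nv H)%:R) = l i ^+ 2 / (p * n%:R) ^+ 2.
  have /andP[q0 q1] := q01 i.
  rewrite /y -(powR_mulrn _ q0) -powRrM mulrCA mulfV ?gt_eqF // mulr1 powR_mulrn //.
  by rewrite expr_div_n real_normK ?num_real.
move: h; under eq_bigr do rewrite yE.
rewrite -mulr_suml S2 => h.
have p20 : 0 < p ^+ 2 by rewrite exprn_gt0.
rewrite -ler_pdivlMr //; apply: le_trans h _.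
rewrite exprMn le_eqVlt; apply/orP; left; apply/eqP; field.
by rewrite !gt_eqF.
Qed.

End Extremal.

(** * The lower bound *)

Section Deviation.
Variables (R : realType) (H : sgraph) (n : nat) (d : R).
Hypothesis n0 : (0 < n)%N.
Hypothesis H_conn : gconnected H.
Local Notation V := 'I_(nv H).
Local Notation p := (d / n%:R).
Hypothesis p01 : 0 < p < 1.
Variable X : 'M[R]_n.
Hypothesis Xd : Xdset d X.

Definition deviation (i j : 'I_n) : R := X i j - p.
Local Notation U := deviation.

Let p0 : 0 < p. Proof. by case/andP: p01. Qed.
Let p1 : p < 1. Proof. by case/andP: p01. Qed.
Let n0R : (0 : R) < n%:R. Proof. by rewrite ltr0n. Qed.
Let Xsym i j : X i j = X j i. Proof. by case: Xd => -[]. Qed.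
Let X01 i j : 0 <= X i j <= 1. Proof. by case: Xd => -[]. Qed.

Lemma deviation_add i j : X i j = p + U i j.
Proof. by rewrite /U addrC subrK. Qed.

Lemma deviation_sym i j : U i j = U j i. Proof. by rewrite /U Xsym. Qed.

Lemma rowsum_X i : \sum_j X i j = n%:R * p.
Proof.
under eq_bigr do rewrite Xsym.
by case: Xd => _ ->; rewrite mulrC divfK ?gt_eqF.
Qed.

Lemma deviation_rowsum i : \sum_j U i j = 0.
Proof. by rewrite /U sumrB rowsum_X sumr_const card_ord -[p *+ n]mulr_natl subrr. Qed.

Lemma deviation_le1 i j : `|U i j| <= 1.
Proof. by have /andP[h0 h1] := X01 i j; have := p0; have := p1; rewrite ler_norml /U; lra. Qed.

Lemma deviation_row_sqr i : avgT (fun j => U i j ^+ 2) <= 2 * p.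
Proof.
apply: (@le_trans _ _ (avgT (fun j => X i j + p))).
  apply: ler_avgT => j; apply: (@le_trans _ _ `|U i j|).
    by rewrite -real_normK ?num_real // expr2 ler_piMr // deviation_le1.
  have /andP[h0 h1] := X01 i j; have := p0; have := p1.
  by rewrite ler_norml /U; lra.
rewrite /avgT card_ord big_split /= rowsum_X sumr_const card_ord -[p *+ n]mulr_natl.
by rewrite -mulrDr mulKf ?gt_eqF // mulr2n mulrDl mul1r.
Qed.

(** The diagonal of U contributes n * p^2, everything else is controlled by
    the entropy. *)
Lemma entropy_ge_deviation (eta : R) : eta <= 1 -> 0 <= ln p^-1 ->
  (forall x, 0 <= x <= 1 -> (1 - eta) * (x - p) ^+ 2 * ln p^-1 <= Ient p x) ->
  (1 - eta) * ln p^-1 *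
    (n%:R ^+ 2 * avg2 (fun i j => U i j ^+ 2) - n%:R * p ^+ 2) <= Imx p X.
Proof.
move=> eta1 L0 ent; have c0 : 0 <= (1 - eta) * ln p^-1 by rewrite mulr_ge0 // subr_ge0.
have -> : n%:R ^+ 2 * avg2 (fun i j => U i j ^+ 2) - n%:R * p ^+ 2 =
    \sum_i \sum_(j | i != j) U i j ^+ 2.
  have -> : n%:R ^+ 2 * avg2 (fun i j => U i j ^+ 2) = \sum_i \sum_j U i j ^+ 2.
    rewrite /avg2 /avgT !card_ord -mulr_sumr; field.
    by rewrite gt_eqF.
  have -> : n%:R * p ^+ 2 = \sum_(i < n) p ^+ 2 by rewrite sumr_const card_ord mulr_natl.
  rewrite -sumrB; apply: eq_bigr => i _; rewrite (bigD1 i) //=.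
  have -> : U i i ^+ 2 = p ^+ 2 by rewrite /U; case: Xd => -[_ _ ->] _; rewrite sub0r sqrrN.
  by rewrite addrAC subrr add0r; apply: eq_bigl => j; rewrite eq_sym.
rewrite mulr_sumr /Imx; apply: ler_sum => i _; rewrite mulr_sumr; apply: ler_sum => j _.
by apply: le_trans (ent _ (X01 i j)); rewrite /U mulrAC.
Qed.

Lemma cost_subadd D s z : (2 <= nv H)%N -> 0 <= s -> 0 <= z <= 1 ->
  cost H D (s + z) <= cost H D s + z `^ (2 / (nv H)%:R) :> R.
Proof.
move=> v2 s0 z01.
have v0R : (0 : R) < (nv H)%:R by rewrite ltr0n; apply: leq_trans v2.
pose al : R := 2 / (nv H)%:R.
have al01 : 0 < al <= 1.
  apply/andP; split; first exact: divr_gt0.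
  by rewrite ler_pdivrMr // mul1r ler_nat.
rewrite /cost; case: ifP => _; first exact: stair_subadd.
by apply: powR_subadd => //; case/andP: z01.
Qed.

(** Few entropy means small deviation, hence only H itself can contribute to
    the excess of the homomorphism density, and the extremal inequality applies. *)
Lemma lower_bound_det (D : nat) (delta eta C : R) :
  (2 <= D)%N -> (0 < ne H)%N -> (forall x : V, (deg x <= D)%N) ->
  0 < eta -> eta <= 2^-1 -> eta < delta -> 0 <= C -> p <= 2^-1 ->
  0 < ln p^-1 -> 1 <= eta * (n%:R * p ^+ D) ->
  (forall x, 0 <= x <= 1 -> (1 - eta) * (x - p) ^+ 2 * ln p^-1 <= Ient p x) ->
  2 ^+ ne H * (2 * C + 1) ^+ ne H * (2 * p) `^ D%:R^-1 <= eta ->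
  1 + delta <= homdens p H X ->
  Imx p X <= C * anp n p H -> maxdeg H = D ->
  gregular H D /\ cost H D (delta - eta) <= C / (1 - eta) + eta.
Proof.
move=> D2 E0 degD eta0 eta2 etad C0 p2 L0 np ent err hom Ile HD.
have eta1 : 0 < 1 - eta by lra.
have pD0 : 0 < p ^+ D by rewrite exprn_gt0.
set S := avg2 (fun i j => U i j ^+ 2).
have Sle : S <= (C / (1 - eta) + eta) * p ^+ D.
  have eta1' : eta <= 1 by lra.
  have := le_trans (entropy_ge_deviation eta1' (ltW L0) ent) Ile.
  rewrite /anp HD -/S => h.
  have h2 : (1 - eta) * (n%:R ^+ 2 * S - n%:R * p ^+ 2) <= C * (n%:R ^+ 2 * p ^+ D).
    by rewrite -(ler_pM2r L0); move: h; lra.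
  have h3 : n%:R * p ^+ 2 <= eta * (n%:R ^+ 2 * p ^+ D).
    have -> : eta * (n%:R ^+ 2 * p ^+ D) = n%:R * (eta * (n%:R * p ^+ D)) by ring.
    rewrite ler_pM2l //; apply: le_trans np; rewrite exprn_ile1 ?ltW //.
  have h4 : n%:R ^+ 2 * S - n%:R * p ^+ 2 <= C / (1 - eta) * (n%:R ^+ 2 * p ^+ D).
    by rewrite [leRHS]mulrAC ler_pdivlMr // mulrC.
  have n2 : (0 : R) < n%:R ^+ 2 by rewrite exprn_gt0.
  rewrite -(ler_pM2l n2); lra.
have SK : S <= (2 * C + 1) * p ^+ D.
  apply: le_trans Sle _; rewrite ler_wpM2r ?(ltW pD0) //; apply: lerD; last by lra.
  by rewrite ler_pdivrMr // -mulrA mulrCA ler_peMr //; lra.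
have r01 : 0 <= 2 * p <= 1 by have := p0; lra.
have K1 : 1 <= 2 * C + 1 by lra.
have := homdens_approx n0 H_conn E0 degD D2 p0 r01 K1 deviation_add deviation_sym
  deviation_rowsum deviation_le1 deviation_row_sqr SK.
move=> /le_trans/(_ err); rewrite ler_norml => /andP[_ approx].
case: ifP approx => [reg approx|_ approx]; last by exfalso; lra.
split=> //; rewrite -(ler_pM2r pD0); apply: le_trans Sle.
apply: (tdens_extremal n0 H_conn D2 E0 _ p0 _ deviation_add _
  deviation_sym deviation_rowsum deviation_le1).
- by move=> x; apply/eqP; move/forallP: reg.
- lra.
- by move=> i j; case/andP: (X01 i j).
- have pe0 : 0 < p ^+ ne H by rewrite exprn_gt0.
  by rewrite -ler_pdivlMr // mulrC; lra.
Qed.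

End Deviation.

(** * Planting cliques in a regular weighted graph *)

Section Stability.
Variables (R : realType) (H : sgraph) (n : nat).
Hypothesis n0 : (0 < n)%N.
Local Notation V := 'I_(nv H).

(** Expanding over the edges that carry the perturbation W, Finner's
    inequality bounds every term. *)
Lemma tdens_stable (A W : 'I_n -> 'I_n -> R) (D : nat) (p eta K : R) :
  (0 < D)%N -> (forall x : V, (deg x <= D)%N) -> 0 < p ->
  0 <= eta <= 1 -> 1 <= K ->
  avg2 (fun i j => `|A i j| ^+ D) <= K * p ^+ D ->
  avg2 (fun i j => `|W i j| ^+ D) <= eta * p ^+ D ->
  `|tdens (edges H) (fun=> fun i j => A i j + W i j) -
    tdens (edges H) (fun=> A)| <=
  2 ^+ ne H * (K ^+ ne H * eta `^ D%:R^-1 * p ^+ ne H).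
Proof.
move=> D0 degD p0 /andP[eta0 eta1] K1 AK We.
have D0R : (0 : R) < D%:R by rewrite ltr0n.
have K0 : 0 < K by apply: lt_le_trans K1.
pose f (F : {set V * V}) e i j := if e \in F then W i j else A i j.
have expand : tdens (edges H) (fun=> fun i j => A i j + W i j) =
    \sum_(F in powerset (edges H)) tdens (edges H) (f F).
  rewrite -avg_sum; apply: avg_eq => phi.
  under eq_bigr do rewrite addrC.
  rewrite prod_distr_powerset; apply: eq_bigr => F; rewrite powersetE => FE.
  rewrite [RHS](big_setID F) /= (finset.setIidPr FE); congr (_ * _).
    by apply: eq_bigr => e eF; rewrite /f eF.
  by apply: eq_bigr => e; rewrite inE /f => /andP[/negPf ->].
rewrite expand (bigD1 finset.set0) ?powersetE ?finset.sub0set //=.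
have -> : tdens (edges H) (f finset.set0) = tdens (edges H) (fun=> A).
  by apply: avg_eq => phi; apply: eq_bigr => e _; rewrite /f inE.
rewrite addrAC subrr add0r; apply: le_trans (ler_norm_sum _ _ _) _.
set B := K ^+ ne H * eta `^ D%:R^-1 * p ^+ ne H.
have B0 : 0 <= B.
  by rewrite !mulr_ge0 ?powR_ge0 ?exprn_ge0 ?(ltW K0) ?(ltW p0).
apply: (@le_trans _ _ (\sum_(F in powerset (edges H)) B)); last first.
  by rewrite sumr_const card_powerset -[B *+ _]mulr_natl natrX.
rewrite [leRHS](bigD1 finset.set0) ?powersetE ?finset.sub0set //=.
rewrite -[leLHS]add0r; apply: lerD => //.
apply: ler_sum => F /andP[]; rewrite powersetE => FE Fn0.
apply: le_trans (ler_norm_avg _) _.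
pose g (e : V * V) i j := `|f F e i j|.
apply: (@le_trans _ _ (tdens (edges H) g)).
  by apply: ler_avg => phi; rewrite normr_prod.
have g0 e i j : e \in edges H -> 0 <= g e i j by rewrite /g.
apply: le_trans (tdens_finner n0 D0 (fintype.subxx _) degD g0) _.
have root (c : R) (Z : 'I_n -> 'I_n -> R) : 0 <= c ->
    avg2 (fun i j => `|Z i j| ^+ D) <= c * p ^+ D ->
    avg2 (fun i j => `|Z i j| ^+ D) `^ D%:R^-1 <= c `^ D%:R^-1 * p.
  move=> c0 Zc; apply: (@le_trans _ _ ((c * p ^+ D) `^ D%:R^-1)).
    apply: ge0_ler_powR; rewrite ?nnegrE ?invr_ge0 //.
      by apply: avg2_ge0 => i j; rewrite exprn_ge0.
    by rewrite mulr_ge0 ?exprn_ge0 ?(ltW p0).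
  by rewrite powRM ?exprn_ge0 ?(ltW p0) // root_exprK ?(ltW p0).
have [e0 e0F] := finset.set0Pn _ Fn0.
have e0E := fintype.subsetP FE _ e0F.
have De1 : D%:R^-1 <= (1 : R) by rewrite invf_le1 // ler1n.
have eta1' : eta `^ D%:R^-1 <= 1.
  apply: (@le_trans _ _ (1 `^ D%:R^-1)); last by rewrite powR1.
  by apply: ge0_ler_powR; rewrite ?nnegrE ?invr_ge0.
have KK : K `^ D%:R^-1 <= K by apply: ler1_powR.
have K1' : 1 <= K `^ D%:R^-1.
  apply: (@le_trans _ _ (1 `^ D%:R^-1)); first by rewrite powR1.
  by apply: ge0_ler_powR; rewrite ?nnegrE ?invr_ge0 ?(ltW K0).
rewrite (bigD1 e0) //=.
have -> : B = (eta `^ D%:R^-1 * p) * (K ^+ ne H * p ^+ (ne H).-1).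
  have := e0E; rewrite /B; have : (0 < ne H)%N by apply/card_gt0P; exists e0.
  by case: (ne H) => // k _ _; rewrite [p ^+ k.+1]exprS /=; ring.
apply: ler_pM; rewrite ?powR_ge0 //.
- by apply: prodr_ge0 => e _; apply: powR_ge0.
- have -> : g e0 = fun i j => `|W i j| by rewrite /g /f e0F.
  exact: root.
apply: (@le_trans _ _ (\prod_(e in edges H | e != e0) (K * p))).
  apply: ler_prod => e /andP[eE ee0]; rewrite powR_ge0 /=.
  have -> : g e = if e \in F then fun i j => `|W i j| else fun i j => `|A i j|.
    by rewrite /g /f; case: ifP.
  case: ifP => _.
    apply: le_trans (root _ _ eta0 We) _; rewrite ler_wpM2r ?(ltW p0) //.
    exact: le_trans eta1' K1.
  apply: le_trans (root _ _ (ltW K0) AK) _; rewrite ler_wpM2r ?(ltW p0) //.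
have -> : \prod_(e in edges H | e != e0) (K * p) = (K * p) ^+ (ne H).-1.
  rewrite (eq_bigl (mem (edges H :\ e0))) => [|e]; last by rewrite !inE andbC.
  by rewrite prodr_const /ne (cardsD1 e0 (edges H)) e0E.
rewrite exprMn ler_wpM2r ?exprn_ge0 ?(ltW p0) //.
by apply: ler_weXn2l => //; exact: leq_pred.
Qed.

End Stability.

Section Construction.
Variables (R : realType) (n M : nat) (p : R) (cls : 'I_n -> option 'I_M).
Local Notation d := (n%:R * p).

Definition clique_size (k : 'I_M) : R := \sum_i (cls i == Some k)%:R.
Local Notation s := clique_size.
Definition covered (i : 'I_n) : R := (cls i != None)%:R.
Local Notation x := covered.
Definition ncovered : R := \sum_k s k.
Local Notation S := ncovered.
Definition cross_weight (k : 'I_M) : R := (d - (s k - 1)) / (n%:R - S).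
Local Notation b := cross_weight.
Definition rest_weight : R := (d - \sum_k s k * b k) / (n%:R - S - 1).
Local Notation c := rest_weight.

(** Disjoint cliques; the edges that a vertex still lacks are spread evenly
    over the vertices outside the cliques. *)
Definition planted : 'M[R]_n := \matrix_(i, j)
  if i == j then 0 else
  match cls i, cls j with
  | Some k, Some l => (k == l)%:R
  | Some k, None => b k
  | None, Some l => b l
  | None, None => c
  end.

Definition same_clique (i j : 'I_n) : R :=
  \sum_k (cls i == Some k)%:R * (cls j == Some k)%:R.

Lemma same_cliqueE i j :
  same_clique i j = if cls i is Some k then (cls j == Some k)%:R else 0.
Proof.
rewrite /same_clique; case: (cls i) => [k|]; last by rewrite big1 // => k _; rewrite mul0r.
rewrite (bigD1 k) //= eqxx mul1r big1 ?addr0 // => l lk.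
by rewrite (_ : Some k == Some l = false) ?mul0r //; apply: contraNF lk => /eqP[->].
Qed.

Lemma covered_sum i : x i = \sum_k (cls i == Some k)%:R.
Proof.
rewrite /covered; case: (cls i) => [k|]; last by rewrite big1.
rewrite (bigD1 k) //= eqxx big1 ?addr0 // => l lk.
by rewrite (_ : Some k == Some l = false) //; apply: contraNF lk => /eqP[->].
Qed.

Lemma sum_covered : \sum_i x i = S.
Proof. by under eq_bigr do rewrite covered_sum; rewrite exchange_big. Qed.

Lemma sum_same_clique : \sum_i \sum_j same_clique i j = \sum_k s k ^+ 2.
Proof.
under eq_bigr do rewrite exchange_big /=.
rewrite exchange_big /=; apply: eq_bigr => k _.
by under eq_bigr do rewrite -mulr_sumr; rewrite -mulr_suml expr2.
Qed.

Hypothesis n8 : (8 <= n)%N.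
Hypothesis p0 : 0 < p.
Hypothesis p4 : p <= 4^-1.
Hypothesis sd : forall k, s k <= d + 1.
Local Notation T := (S + 1).
Hypothesis T2 : 16 * T ^+ 2 <= n%:R ^+ 2 * p.

Let n8R : (8 : R) <= n%:R. Proof. by rewrite (ler_nat R 8). Qed.
Let s0 k : 0 <= s k. Proof. by apply: sumr_ge0 => i _; rewrite ler0n. Qed.
Let S0 : 0 <= S. Proof. by apply: sumr_ge0 => k _. Qed.
Let sS k : s k <= S.
Proof. by rewrite /ncovered (bigD1 k) //= lerDl sumr_ge0. Qed.

Let T8 : 8 * T <= n%:R.
Proof.
have h : (8 * T) ^+ 2 <= n%:R ^+ 2.
  have -> : (8 * T) ^+ 2 = 4 * (16 * T ^+ 2) by ring.
  apply: (@le_trans _ _ (4 * (n%:R ^+ 2 * p))); first by rewrite ler_pM2l.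
  have -> : 4 * (n%:R ^+ 2 * p) = n%:R ^+ 2 * (4 * p) by ring.
  by rewrite ler_piMr ?exprn_ge0 //; have := p4; lra.
have := n8R; have := S0 => S0' nR.
by move: h; rewrite ler_sqr ?nnegrE //; lra.
Qed.

Let rest0 : 0 < n%:R - S. Proof. by have := T8; have := S0; lra. Qed.
Let rest1 : 0 < n%:R - S - 1. Proof. by have := T8; have := S0; lra. Qed.

Ltac numeric_bounds :=
  have pp0 := p0; have pp4 := p4; have TT2 := T2; have nR := n8R; have Sge0 := S0; have TR := T8;
  have restR := rest0; have restR1 := rest1.

Lemma cross_weight_near k : `|b k - p| <= 2 * T / n%:R.
Proof.
numeric_bounds.
have -> : b k - p = (s k - 1 - p * S) / (n%:R - S) * -1.
  by rewrite /cross_weight; field; lra.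
rewrite normrM normrN1 mulr1 normrM normfV [`|n%:R - S|]gtr0_norm //.
have h : `|s k - 1 - p * S| <= T.
  rewrite ler_norml; have := sS k; have := s0 k.
  have : p * S <= 1 * S by rewrite ler_wpM2r //; lra.
  have : 0 <= p * S by rewrite mulr_ge0 // ltW.
  by lra.
rewrite ler_pdivrMr //; apply: le_trans h _.
rewrite mulrAC ler_pdivlMr; last by lra.
have : T * (2 * (n%:R - S)) >= T * n%:R by rewrite ler_wpM2l //; lra.
lra.
Qed.

Lemma rest_weight_near : `|c - p| <= 2 * (p + 2 * T ^+ 2 / n%:R) / n%:R.
Proof.
numeric_bounds.
have -> : c - p = (p + \sum_k s k * (p - b k)) / (n%:R - S - 1).
  have -> : \sum_k s k * (p - b k) = S * p - \sum_k s k * b k.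
    by rewrite /ncovered mulr_suml -sumrB; apply: eq_bigr => k _; rewrite mulrBr.
  by rewrite /rest_weight; move: (\sum_k _) => z; field; lra.
rewrite normrM normfV [`|n%:R - S - 1|]gtr0_norm //.
have n1 : (0 : R) < n%:R by lra.
have h : `|p + \sum_k s k * (p - b k)| <= p + 2 * T ^+ 2 / n%:R.
  apply: le_trans (ler_normD _ _) _; rewrite gtr0_norm // lerD2l.
  apply: le_trans (ler_norm_sum _ _ _) _.
  apply: (@le_trans _ _ (\sum_k s k * (2 * T / n%:R))).
    apply: ler_sum => k _; rewrite normrM ger0_norm // distrC.
    by rewrite ler_wpM2l // cross_weight_near.
  rewrite -mulr_suml -/S.
  apply: (@le_trans _ _ (T * (2 * T / n%:R))).
    by rewrite ler_wpM2r ?divr_ge0 //; lra.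
  by rewrite le_eqVlt; apply/orP; left; apply/eqP; field; lra.
rewrite ler_pdivrMr //; apply: le_trans h _.
have [Y YE] : exists Y, Y = p + 2 * T ^+ 2 / n%:R by eexists.
have Y0 : 0 <= Y.
  rewrite YE; apply: addr_ge0; first exact: ltW.
  by rewrite divr_ge0 ?(ltW n1) // mulr_ge0 ?sqr_ge0.
rewrite -YE [leRHS]mulrAC ler_pdivlMr //.
have : Y * (2 * (n%:R - S - 1)) >= Y * n%:R by rewrite ler_wpM2l //; lra.
lra.
Qed.

Lemma planted_Xdset : Xdset d planted.
Proof.
numeric_bounds.
have n1 : (0 : R) < n%:R by lra.
have b01 k : 0 <= b k <= 1.
  have := cross_weight_near k; rewrite ler_norml => /andP[_ h].
  have : 2 * T / n%:R <= 4^-1 by rewrite ler_pdivrMr //; lra.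
  have : 0 <= b k by rewrite divr_ge0 ?(ltW rest0) //; have := sd k; lra.
  by move: h; lra.
have c01 : 0 <= c <= 1.
  have := rest_weight_near; rewrite ler_norml => /andP[h1 h2].
  have : 2 * (p + 2 * T ^+ 2 / n%:R) / n%:R <= p / 2.
    rewrite ler_pdivrMr // mulrDr.
    have : 2 * p <= p / 4 * n%:R.
      have : p * 8 <= p * n%:R by rewrite ler_wpM2l // ltW.
      lra.
    have : 2 * (2 * T ^+ 2 / n%:R) <= p / 4 * n%:R; last by lra.
    rewrite mulrA ler_pdivrMr //; lra.
  by move: h1 h2; lra.
split.
  split.
  - move=> i j; rewrite !mxE eq_sym; case: eqP => // _.
    by case: (cls i) => [k|]; case: (cls j) => [l|] //; rewrite eq_sym.
  - move=> i j; rewrite !mxE; case: eqP => [_|_]; first by rewrite lexx ler01.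
    case: (cls i) => [k|]; case: (cls j) => [l|] //.
    by case: eqP => _; rewrite ?lexx ?ler01.
  - by move=> i; rewrite mxE eqxx.
move=> j; have symX : forall i, planted i j = planted j i.
  move=> i; rewrite !mxE eq_sym; case: eqP => // _.
  by case: (cls i) => [k|]; case: (cls j) => [l|] //; rewrite eq_sym.
under eq_bigr do rewrite symX.
case cj: (cls j) => [k|].
- transitivity (\sum_i ((cls i == Some k)%:R + b k * (1 - x i) - (i == j)%:R)).
    apply: eq_bigr => i _; rewrite mxE eq_sym /covered.
    have [->|ij] := eqVneq i j; first by rewrite cj !eqxx /=; ring.
    rewrite cj; case ci: (cls i) => [l|] /=; last by ring.
    have -> : (Some l == Some k) = (k == l).
      by apply/eqP/eqP => [[->]|->].
    by ring.
  rewrite sumrB big_split /= -mulr_sumr sumrB sumr_const card_ord sum_covered.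
  rewrite (bigD1 j) //= cj eqxx.
  have -> : \sum_(i < n) (i == j)%:R = 1 :> R.
    by rewrite (bigD1 j) //= eqxx big1 ?addr0 // => i /negPf ->.
  have -> : 1 + \sum_(i < n | i != j) (cls i == Some k)%:R = s k.
    by rewrite /clique_size [RHS](bigD1 j) //= cj eqxx.
  by rewrite /cross_weight; field; lra.
- transitivity (\sum_i ((\sum_k (cls i == Some k)%:R * b k) + c * (1 - x i) -
                        (i == j)%:R * c)).
    apply: eq_bigr => i _; rewrite mxE eq_sym /covered.
    have sumk l : \sum_k (Some l == Some k)%:R * b k = b l.
      rewrite (bigD1 l) //= eqxx mul1r big1 ?addr0 // => l' l'l.
      by rewrite (_ : Some l == Some l' = false) ?mul0r //; apply: contraNF l'l => /eqP[->].
    have sumN : \sum_k (None == Some k :> option 'I_M)%:R * b k = 0.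
      by rewrite big1 // => l _; rewrite mul0r.
    have [->|ij] := eqVneq i j; first by rewrite cj sumN /=; ring.
    rewrite cj; case ci: (cls i) => [l|] /=; first by rewrite sumk; ring.
    by rewrite sumN; ring.
  rewrite sumrB big_split /= -mulr_sumr sumrB sumr_const card_ord sum_covered.
  rewrite -mulr_suml.
  have -> : \sum_(i < n) (i == j)%:R = 1 :> R.
    by rewrite (bigD1 j) //= eqxx big1 ?addr0 // => i /negPf ->.
  rewrite exchange_big /=; under eq_bigr do rewrite -mulr_suml.
  rewrite /rest_weight -/(s _); move: (\sum_k _) => z.
  by field; lra.
Qed.

(** Bounds the squared deviation from p of an entry off the cliques.  Its three
    terms account for two vertices in different cliques, for one vertex in a
    clique, and for none. *)
Definition offset (i j : 'I_n) : R :=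
  p ^+ 2 * (x i * x j) + (2 * T / n%:R) ^+ 2 * (x i + x j) +
  (2 * (p + 2 * T ^+ 2 / n%:R) / n%:R) ^+ 2.

Lemma offset_ge0 i j : 0 <= offset i j.
Proof.
have x0 a : 0 <= x a by rewrite ler0n.
apply: addr_ge0; last exact: sqr_ge0.
apply: addr_ge0; apply: mulr_ge0; rewrite ?sqr_ge0 //; last exact: addr_ge0.
exact: mulr_ge0.
Qed.

Lemma planted_offset i j : i != j ->
  (planted i j - p - same_clique i j) ^+ 2 <= offset i j /\
  (same_clique i j = 1 /\ planted i j = 1 \/
   same_clique i j = 0 /\ (planted i j - p) ^+ 2 <= offset i j).
Proof.
numeric_bounds.
move=> ij; rewrite mxE (negPf ij) same_cliqueE /offset /covered.
set B := (2 * T / n%:R) ^+ 2; set C := (2 * (_ + _) / _) ^+ 2.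
have B0 : 0 <= B by apply: sqr_ge0.
have C0 : 0 <= C by apply: sqr_ge0.
have bB k : (b k - p) ^+ 2 <= B.
  rewrite -real_normK ?num_real // ler_sqr ?nnegrE ?cross_weight_near //.
  exact: le_trans (cross_weight_near k).
have cC : (c - p) ^+ 2 <= C.
  rewrite -real_normK ?num_real // ler_sqr ?nnegrE ?rest_weight_near //.
  exact: le_trans rest_weight_near.
case: (cls i) => [k|]; case: (cls j) => [l|] /=.
- have -> : (Some l == Some k) = (k == l).
    by apply/eqP/eqP => [[->]|->].
  rewrite mulr1n; case: eqP => _ /=; rewrite ?mulr1n ?mulr0n.
    split; last by left.
    by rewrite (_ : (1 - p - 1) ^+ 2 = p ^+ 2); [lra|ring].
  rewrite subr0; split; last right; last split=> //;
    by rewrite (_ : (0 - p) ^+ 2 = p ^+ 2); [lra|ring].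
- by rewrite subr0; have := bB k; split; [|right; split=> //]; lra.
- by rewrite subr0; have := bB l; split; [|right; split=> //]; lra.
- by rewrite subr0; split; [|right; split=> //]; lra.
Qed.

Lemma sum_offset : \sum_i \sum_j offset i j <=
  T ^+ 2 * p ^+ 2 + 8 * T ^+ 3 / n%:R + 8 * p ^+ 2 + 32 * T ^+ 4 / n%:R ^+ 2.
Proof.
numeric_bounds.
have n1 : (0 : R) < n%:R by lra.
have -> : \sum_i \sum_j offset i j = p ^+ 2 * S ^+ 2 +
    (2 * T / n%:R) ^+ 2 * (2 * n%:R * S) +
    n%:R ^+ 2 * (2 * (p + 2 * T ^+ 2 / n%:R) / n%:R) ^+ 2.
  rewrite /offset.
  move: ((2 * T / n%:R) ^+ 2) ((2 * (p + 2 * T ^+ 2 / n%:R) / n%:R) ^+ 2) => B C.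
  transitivity (\sum_i (p ^+ 2 * (x i * S) + B * (n%:R * x i + S) + n%:R * C)).
    apply: eq_bigr => i _; rewrite !big_split /= -!mulr_sumr sum_covered.
    rewrite big_split /= sum_covered !sumr_const card_ord.
    by rewrite -[x i *+ n]mulr_natl -[C *+ n]mulr_natl.
  rewrite !big_split /= -!mulr_sumr big_split /= -mulr_sumr -mulr_suml sum_covered.
  rewrite !sumr_const card_ord -[S *+ n]mulr_natl -[C *+ n]mulr_natl.
  ring.
have e1 : (2 * T / n%:R) ^+ 2 * (2 * n%:R * S) = 8 * T ^+ 2 * S / n%:R by field; lra.
have e2 : n%:R ^+ 2 * (2 * (p + 2 * T ^+ 2 / n%:R) / n%:R) ^+ 2 =
    4 * (p + 2 * T ^+ 2 / n%:R) ^+ 2.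
  by move: (_ + _) => y; field; lra.
rewrite e1 e2.
have f1 : p ^+ 2 * S ^+ 2 <= T ^+ 2 * p ^+ 2.
  rewrite mulrC ler_wpM2r ?sqr_ge0 // ler_sqr ?nnegrE; lra.
have f2 : 8 * T ^+ 2 * S / n%:R <= 8 * T ^+ 3 / n%:R.
  rewrite ler_wpM2r ?invr_ge0 ?(ltW n1) // [T ^+ 3]exprSr mulrA.
  by rewrite ler_wpM2l ?mulr_ge0 ?sqr_ge0 //; lra.
have f3 : 4 * (p + 2 * T ^+ 2 / n%:R) ^+ 2 <= 8 * p ^+ 2 + 32 * T ^+ 4 / n%:R ^+ 2.
  have -> : 32 * T ^+ 4 / n%:R ^+ 2 = 8 * (2 * T ^+ 2 / n%:R) ^+ 2 by field; lra.
  move: (2 * T ^+ 2 / n%:R) => y.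
  have := sqr_ge0 (p - y); lra.
lra.
Qed.

Lemma planted_perturbation :
  n%:R ^+ 2 * avg2 (fun i j => (planted i j - p - same_clique i j) ^+ 2) <=
  4 * T + n%:R * p ^+ 2 + \sum_i \sum_j offset i j.
Proof.
numeric_bounds.
have n1 : (0 : R) < n%:R by lra.
have -> : n%:R ^+ 2 * avg2 (fun i j => (planted i j - p - same_clique i j) ^+ 2) =
    \sum_i \sum_j (planted i j - p - same_clique i j) ^+ 2.
  by rewrite /avg2 /avgT !card_ord -mulr_sumr; field; lra.
have off0 := offset_ge0.
apply: (@le_trans _ _ (\sum_i (4 * x i + p ^+ 2 + \sum_j offset i j))); last first.
  rewrite !big_split /= -mulr_sumr sum_covered sumr_const card_ord -[p ^+ 2 *+ n]mulr_natl.
  lra.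
apply: ler_sum => i _; rewrite (bigD1 i) //=; apply: lerD.
  (* The planted matrix vanishes on the diagonal, same_clique does not. *)
  rewrite mxE eqxx same_cliqueE /covered.
  case: (cls i) => [k|] /=.
    rewrite eqxx mulr1n mulr1 sub0r -opprD sqrrN.
    have : p ^+ 2 <= p * 4^-1 by rewrite expr2 ler_wpM2l // ltW.
    by rewrite sqrrD; lra.
  by rewrite subr0 sub0r sqrrN; have := sqr_ge0 p; lra.
rewrite [leRHS](bigD1 i) //= -[leLHS]add0r; apply: lerD => //.
by apply: ler_sum => j ji; rewrite eq_sym in ji; case: (planted_offset ji).
Qed.

Lemma planted_entropy : Imx p planted <=
  (\sum_k s k ^+ 2) * ln p^-1 + 2 / p * \sum_i \sum_j offset i j.
Proof.
numeric_bounds.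
have n1 : (0 : R) < n%:R by lra.
have p01 : 0 < p < 1 by rewrite p0 /=; lra.
have L0 : 0 <= ln p^-1.
  by rewrite ln_ge0 // invf_ge1 //; lra.
have off0 := offset_ge0.
have sc0 i j : 0 <= same_clique i j.
  by apply: sumr_ge0 => k _; rewrite mulr_ge0.
rewrite -sum_same_clique mulr_suml mulr_sumr -big_split /=.
apply: ler_sum => i _; rewrite mulr_suml mulr_sumr -big_split /= big_mkcond /=.
apply: ler_sum => j _; case: ifP => [ij|_]; last first.
  by rewrite addr_ge0 ?mulr_ge0 ?invr_ge0 ?(ltW p0).
case: (planted_offset ij) => _ [[-> ->]|[-> h]].
  by rewrite Ient1 mul1r lerDl mulr_ge0 ?divr_ge0 ?(ltW p0).
rewrite mul0r add0r.
have X01 : 0 <= planted i j <= 1 by case: planted_Xdset => -[].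
apply: le_trans (Ient_le_sqr p01 X01) _.
rewrite ler_pdivrMr ?mulr_gt0 //; last by lra.
apply: le_trans h _.
have -> : 2 / p * offset i j * (p * (1 - p)) = offset i j * (2 * (1 - p)).
  by field; rewrite gt_eqF.
by rewrite ler_peMr //; lra.
Qed.

End Construction.

(** * Clique sizes and the density they produce *)

Section PlantedDensity.
Variables (R : realType) (H : sgraph).
Local Notation V := 'I_(nv H).

Lemma exists_classes (n M : nat) (t : 'I_M -> nat) : (\sum_k t k <= n)%N ->
  exists cls : 'I_n -> option 'I_M, forall k, clique_size R cls k = (t k)%:R.
Proof.
move=> tn; pose L := flatten [seq nseq (t k) (Some k) | k <- enum 'I_M] ++
                     nseq (n - \sum_k t k)%N None.
have sumt : sumn [seq t k | k <- enum 'I_M] = (\sum_k t k)%N.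
  by rewrite sumnE big_map big_enum.
have sL : size L = n.
  rewrite size_cat size_flatten /shape -map_comp size_nseq.
  rewrite (eq_map (g := t)) => [|k]; last by rewrite /= size_nseq.
  by rewrite sumt subnKC.
exists (fun i => nth None L i) => k.
have -> : clique_size R (fun i : 'I_n => nth None L i) k =
    (\sum_(i < n) (nth None L i == Some k))%N%:R by rewrite natr_sum.
congr (_%:R); transitivity (count_mem (Some k) L).
  rewrite -sum1_count (big_nth None) sL big_mkord [RHS]big_mkcond /=.
  by apply: eq_bigr => i _ /=; case: eqP.
rewrite count_cat count_nseq /= mul0n addn0 count_flatten -map_comp sumnE big_map.
rewrite big_enum /= (bigD1 k) //= count_nseq /= eqxx mul1n big1 ?addn0 // => l lk.
by rewrite count_nseq /= (_ : Some l == Some k = false) //; apply: contraNF lk => /eqP[->].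
Qed.

(** The clique sizes in units of n p^(D/2).  For D = 2 a clique has size at most
    p n, so the scales are floor s ones and a remainder. *)
Lemma exists_clique_scales (D : nat) (s : R) : (2 <= nv H)%N -> 0 <= s ->
  exists (M : nat) (al : 'I_M -> R), [/\ forall k, 0 <= al k,
    \sum_k al k ^+ nv H = s, \sum_k al k ^+ 2 = cost H D s &
    D = 2%N -> forall k, al k <= 1].
Proof.
move=> v2 s0; have v0 : (0 < nv H)%N by apply: leq_trans v2.
have v0R : (0 : R) < (nv H)%:R by rewrite ltr0n.
have root (f : R) : 0 <= f -> (f `^ (nv H)%:R^-1) ^+ nv H = f.
  move=> f0; rewrite -powR_mulrn ?powR_ge0 // -powRrM mulVf ?powRr1 //.
  by rewrite gt_eqF.
have sqr (f : R) : (f `^ (nv H)%:R^-1) ^+ 2 = f `^ (2 / (nv H)%:R).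
  by rewrite -powR_mulrn ?powR_ge0 // -powRrM mulrC.
rewrite /cost; case: eqP => [->|D2]; last first.
  exists 1%N, (fun=> s `^ (nv H)%:R^-1); split => // [k||].
  - exact: powR_ge0.
  - by rewrite big_ord1 root.
  - by rewrite big_ord1 sqr.
have fl0 : (0 <= Num.floor s)%R by rewrite floor_ge0.
have mE : (`|Num.floor s|%N%:R : R) = intpart s.
  by rewrite /intpart -[in RHS](gez0_abs fl0).
have /andP[f0 f1] := fracpart_itv s.
pose m := `|Num.floor s|%N.
exists m.+1, (fun k => if (k < m)%N then 1 else fracpart s `^ (nv H)%:R^-1).
have sumE (j : nat) : \sum_(k < m.+1)
    (if (k < m)%N then 1 else fracpart s `^ (nv H)%:R^-1) ^+ j =
    intpart s + (fracpart s `^ (nv H)%:R^-1) ^+ j.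
  rewrite big_ord_recr /= ltnn; congr (_ + _).
  rewrite (eq_bigr (fun=> 1)) => [|k _]; last by rewrite ltn_ord expr1n.
  by rewrite sumr_const card_ord.
split.
- by move=> k; case: ifP => // _; exact: powR_ge0.
- by rewrite sumE root // /fracpart; ring.
- by rewrite sumE sqr.
- move=> _ k; case: ifP => // _.
  apply: (@le_trans _ _ (1 `^ (nv H)%:R^-1)); last by rewrite powR1.
  by apply: ge0_ler_powR; rewrite ?nnegrE ?invr_ge0 ?(ltW v0R) ?(ltW f1).
Qed.

(** Only the maps of H into a single clique are counted. *)
Lemma tdens_same_clique (n M : nat) (cls : 'I_n -> option 'I_M) :
  gconnected H -> (0 < n)%N ->
  \sum_k (clique_size R cls k / n%:R) ^+ nv H <=
  tdens (edges H) (fun=> same_clique R cls).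
Proof.
move=> [v0 _] n0.
have E (k : 'I_M) : (clique_size R cls k / n%:R) ^+ nv H =
    avg (fun phi : {ffun V -> 'I_n} => \prod_x (cls (phi x) == Some k)%:R).
  rewrite /avg !card_ord -(bigA_distr_bigA (fun (x : V) i => (cls i == Some k)%:R)).
  by rewrite prodr_const card_ord expr_div_n mulrC.
under eq_bigr do rewrite E.
rewrite -avg_sum; apply: ler_avg => phi.
have [[k hk]|nok] := pselect (exists k, forall x, cls (phi x) = Some k); last first.
  rewrite big1 => [|k _].
    by apply: prodr_ge0 => e _; apply: sumr_ge0 => k _; rewrite mulr_ge0.
  apply/eqP; rewrite prodf_seq_eq0; apply/hasP.
  apply: contrapT => no; apply: nok; exists k => x.
  apply/eqP; apply: contraT => /negPf xk; exfalso; apply: no.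
  by exists x; rewrite ?mem_index_enum //= xk eqxx.
rewrite (bigD1 k) //= big1 => [|x _]; last by rewrite hk eqxx.
rewrite big1 ?addr0 => [|l lk]; last first.
  rewrite (bigD1 (Ordinal v0)) //= hk.
  by rewrite (_ : Some k == Some l = false) ?mul0r //; apply: contraNF lk => /eqP[->].
rewrite big1 // => e _; rewrite same_cliqueE !hk eqxx //.
Qed.

Lemma exprB_le (v : nat) (a y c r : R) : 0 <= y -> 0 <= a -> a <= c -> 1 <= c ->
  a - y <= r -> 0 <= r -> a ^+ v - y ^+ v <= v%:R * c ^+ v * r.
Proof.
move=> y0 a0 ac c1 ayr r0; have c0 : 0 <= c by lra.
elim: v => [|v IH]; first by rewrite !expr0 subrr !mul0r.
have [ya|ay] := leP a y.
  apply: (@le_trans _ _ 0); last by rewrite !mulr_ge0 ?exprn_ge0.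
  by rewrite subr_le0; apply: lerXn2r; rewrite ?nnegrE.
have -> : a ^+ v.+1 - y ^+ v.+1 = a * (a ^+ v - y ^+ v) + (a - y) * y ^+ v.
  by rewrite !exprS; ring.
have -> : v.+1%:R * c ^+ v.+1 * r = c * (v%:R * c ^+ v * r) + r * c ^+ v.+1.
  by rewrite -nat1r exprS; ring.
apply: lerD.
  have d0 : 0 <= a ^+ v - y ^+ v.
    by rewrite subr_ge0; apply: lerXn2r; rewrite ?nnegrE // ltW.
  by apply: ler_pM.
apply: ler_pM; rewrite ?exprn_ge0 ?subr_ge0 ?(ltW ay) //.
apply: (@le_trans _ _ (c ^+ v)).
  by apply: lerXn2r; rewrite ?nnegrE //; apply: le_trans ac; exact: ltW.
by rewrite ler_weXn2l.
Qed.

End PlantedDensity.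

(** * The upper bound *)

Section UpperBound.
Variables (R : realType) (H : sgraph) (n M D : nat) (p : R) (al : 'I_M -> R).
Hypothesis n8 : (8 <= n)%N.
Hypothesis H_conn : gconnected H.
Hypothesis D2 : (2 <= D)%N.
Hypothesis E0 : (0 < ne H)%N.
Hypothesis degD : forall x : 'I_(nv H), deg x = D.
Hypothesis p0 : 0 < p.
Hypothesis p4 : p <= 4^-1.
Hypothesis al0 : forall k, 0 <= al k.

(** The k-th clique has size about al k * q * n. *)
Let q : R := Num.sqrt (p ^+ D).
Let kap : R := \sum_k al k + 1.
Let Y : R := n%:R * p ^+ D.
Let C2 : R := kap ^+ 2 + 8 * kap ^+ 3 + 8 + 32 * kap ^+ 4.
(** Bounds the average of |W|^D / p^D, where W is the part of the deviation that
    is not due to the cliques. *)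
Let eta : R := 2 ^+ D * ((4 * kap + 1) / Y + C2 * p).

Hypothesis alq : forall k, al k * q <= p.
Hypothesis kapp : 16 * kap ^+ 2 * p <= 1.
Hypothesis Y1 : 1 <= Y.
Hypothesis eta1 : eta <= 1.

Let n1 : (1 : R) <= n%:R. Proof. by rewrite ler1n; apply: leq_trans n8. Qed.
Let n0R : (0 : R) < n%:R. Proof. exact: lt_le_trans n1. Qed.
Let n0 : (0 < n)%N. Proof. exact: leq_trans n8. Qed.
Let pD0 : 0 < p ^+ D. Proof. exact: exprn_gt0. Qed.
Let p1 : p <= 1. Proof. by have := p4; lra. Qed.
Let q2 : q ^+ 2 = p ^+ D. Proof. by rewrite sqr_sqrtr // ltW. Qed.
Let q0 : 0 < q. Proof. by rewrite sqrtr_gt0. Qed.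

Let qp : q <= p.
Proof.
rewrite -ler_sqr ?nnegrE ?(ltW p0) ?(ltW q0) // q2.
by apply: ler_wiXn2l; rewrite ?(ltW p0).
Qed.

Let kap1 : 1 <= kap. Proof. by rewrite lerDr; apply: sumr_ge0. Qed.

Local Notation A := (n%:R * q).

Let AY : A ^+ 2 = n%:R * Y. Proof. by rewrite exprMn q2 /Y; ring. Qed.

Let YA : Y <= A.
Proof.
have pD1 : p ^+ D <= 1 by rewrite exprn_ile1 // ltW.
rewrite -ler_sqr ?nnegrE ?mulr_ge0 ?(ltW n0R) ?(ltW q0) //; last exact: ltW.
rewrite AY expr2 ler_wpM2r //; first by apply: le_trans Y1.
by rewrite /Y ler_piMr // ltW.
Qed.

Let A1 : 1 <= A. Proof. exact: le_trans YA. Qed.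

Let t (k : 'I_M) : nat := Num.truncn (al k * A).

Let tA k : (t k)%:R <= al k * A.
Proof. by rewrite truncn_le mulr_ge0 //; apply: le_trans A1. Qed.

Let At k : al k * A <= (t k)%:R + 1.
Proof.
rewrite natr1; apply: ltW; have := @truncn_itv _ (al k * A).
by rewrite mulr_ge0 ?al0 //; [move=> /(_ isT)/andP[]|apply: le_trans A1].
Qed.

Let St : \sum_k (t k)%:R + 1 <= kap * A.
Proof.
rewrite /kap mulrDl mul1r; apply: lerD => //.
by rewrite mulr_suml; apply: ler_sum.
Qed.

Let ToA : 16 * (\sum_k (t k)%:R + 1) ^+ 2 <= n%:R ^+ 2 * p.
Proof.
have T0 : 0 <= \sum_k (t k)%:R + 1 :> R by rewrite addr_ge0 // sumr_ge0.
apply: (@le_trans _ _ (16 * (kap * A) ^+ 2)).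
  rewrite ler_pM2l // ler_sqr ?nnegrE //; exact: le_trans St.
have -> : 16 * (kap * A) ^+ 2 = n%:R ^+ 2 * (16 * kap ^+ 2 * q ^+ 2) by ring.
rewrite ler_wpM2l ?sqr_ge0 //.
apply: (@le_trans _ _ (16 * kap ^+ 2 * p * p)).
  rewrite -[leRHS]mulrA; apply: ler_wpM2l; first by apply: mulr_ge0 => //; exact: sqr_ge0.
  rewrite -expr2.
  by rewrite ler_sqr ?nnegrE ?(ltW p0) ?(ltW q0).
by rewrite -[leRHS]mul1r ler_wpM2r // ltW.
Qed.

Let tn : (\sum_k t k <= n)%N.
Proof.
rewrite -(ler_nat R) natr_sum.
have T0 : 0 <= \sum_k (t k)%:R :> R by rewrite sumr_ge0.
have h : (\sum_k (t k)%:R + 1) ^+ 2 <= n%:R ^+ 2 :> R.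
  have : n%:R ^+ 2 * p <= n%:R ^+ 2 * 1 by rewrite ler_wpM2l ?sqr_ge0.
  have := sqr_ge0 (\sum_k (t k)%:R + 1 : R).
  by have := ToA; lra.
move: h; rewrite ler_sqr ?nnegrE ?(ltW n0R) //; lra.
Qed.

Lemma pow_ne_q : p ^+ ne H = q ^+ nv H.
Proof.
apply/eqP; rewrite -(@eqrXn2 _ 2) ?exprn_ge0 ?(ltW p0) ?(ltW q0) //; apply/eqP.
rewrite -!exprM (handshake degD) [(nv H * 2)%N]mulnC [in RHS]exprM q2.
by rewrite -exprM mulnC.
Qed.

(** The cliques account for the term with the logarithm, and all other entries
    together cost O(n^2 p^D) only.  The three terms subtracted from the density come from rounding
    the clique sizes, from the perturbation W, and from the proper subgraphs
    of H. *)
Lemma upper_bound_det : exists X : 'M[R]_n, [/\ Xdset (n%:R * p) X,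
  Imx p X <= ((\sum_k al k ^+ 2) * ln p^-1 + 2 * C2) * (n%:R ^+ 2 * p ^+ D) &
  1 + \sum_k al k ^+ nv H - M%:R * ((nv H)%:R * kap ^+ nv H / Y)
    - 2 ^+ ne H * (kap ^+ 2) ^+ ne H * eta `^ D%:R^-1
    - 2 ^+ ne H * (2 * kap ^+ 2 + 2) ^+ ne H * (2 * p) `^ D%:R^-1
  <= homdens p H X].
Proof.
have [cls clsE] := exists_classes R tn.
have SE : ncovered R cls = \sum_k (t k)%:R by apply: eq_bigr => k _; exact: clsE.
have sd k : clique_size R cls k <= n%:R * p + 1.
  rewrite clsE; apply: le_trans (tA k) _; rewrite mulrCA.
  have : n%:R * (al k * q) <= n%:R * p by rewrite ler_pM2l.
  lra.
have T2 : 16 * (ncovered R cls + 1) ^+ 2 <= n%:R ^+ 2 * p by rewrite SE.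
set X := planted p cls.
have XX : Xdset (n%:R * p) X := planted_Xdset n8 p0 p4 sd T2.
have A0 : 0 < A by apply: lt_le_trans A1.
have Y0 : 0 < Y by apply: lt_le_trans Y1.
have k0 : 0 < kap by apply: lt_le_trans kap1.
have C20 : 0 < C2.
  have := exprn_gt0 2 k0; have := exprn_gt0 3 k0; have := exprn_gt0 4 k0.
  by rewrite /C2; lra.
have A2 : A ^+ 2 = n%:R ^+ 2 * p ^+ D by rewrite exprMn q2.
set T := ncovered R cls + 1 in T2.
have T1 : 0 <= T by rewrite /T SE addr_ge0 // sumr_ge0.
have TA : T <= kap * A by rewrite /T SE.
(* all the correction terms are of order n^2 p^(D+1) *)
have offs : \sum_i \sum_j offset p cls i j <= C2 * A ^+ 2 * p.
  apply: le_trans (sum_offset n8 p0 p4 T2) _; rewrite -/T.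
  have Tk (j : nat) : T ^+ j <= kap ^+ j * A ^+ j.
    by rewrite -exprMn; apply: lerXn2r; rewrite ?nnegrE //; apply: le_trans TA.
  have pp : p ^+ 2 <= p by rewrite expr2 ler_piMl // ltW.
  have qq : q ^+ 2 <= p.
    by apply: le_trans pp; rewrite ler_sqr ?nnegrE ?(ltW p0) ?(ltW q0).
  have A20 : 0 <= A ^+ 2 by apply: sqr_ge0.
  have h1 : T ^+ 2 * p ^+ 2 <= kap ^+ 2 * A ^+ 2 * p.
    by apply: ler_pM => //; rewrite sqr_ge0.
  have h2 : 8 * T ^+ 3 / n%:R <= 8 * kap ^+ 3 * A ^+ 2 * p.
    apply: (@le_trans _ _ (8 * (kap ^+ 3 * A ^+ 3) / n%:R)).
      by rewrite ler_wpM2r ?invr_ge0 ?(ltW n0R) // ler_pM2l.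
    have -> : 8 * (kap ^+ 3 * A ^+ 3) / n%:R = 8 * kap ^+ 3 * A ^+ 2 * q.
      by rewrite [A ^+ 3]exprSr; field; rewrite gt_eqF.
    by rewrite ler_wpM2l // !mulr_ge0 ?exprn_ge0 ?(ltW k0) ?(ltW q0).
  have h3 : 8 * p ^+ 2 <= 8 * A ^+ 2 * p.
    apply: ler_pM; rewrite ?sqr_ge0 //.
    by rewrite ler_peMr // exprn_ege1.
  have h4 : 32 * T ^+ 4 / n%:R ^+ 2 <= 32 * kap ^+ 4 * A ^+ 2 * p.
    apply: (@le_trans _ _ (32 * (kap ^+ 4 * A ^+ 4) / n%:R ^+ 2)).
      by rewrite ler_wpM2r ?invr_ge0 ?sqr_ge0 // ler_pM2l.
    have -> : 32 * (kap ^+ 4 * A ^+ 4) / n%:R ^+ 2 = 32 * kap ^+ 4 * A ^+ 2 * q ^+ 2.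
      by rewrite (_ : A ^+ 4 = A ^+ 2 * A ^+ 2) -?exprD // exprMn; field; rewrite gt_eqF.
    by rewrite ler_wpM2l // !mulr_ge0 ?exprn_ge0 ?(ltW k0) ?(ltW q0).
  rewrite /C2; lra.
exists X; split=> //.
  apply: le_trans (planted_entropy n8 p0 p4 sd T2) _; rewrite [leRHS]mulrDl -A2.
  apply: lerD.
    rewrite mulrAC ler_wpM2r //.
      by rewrite ln_ge0 // invf_ge1.
    rewrite mulr_suml; apply: ler_sum => k _.
    by rewrite clsE -exprMn; apply: lerXn2r; rewrite ?nnegrE ?mulr_ge0 // ltW.
  apply: le_trans (ler_wpM2l _ offs) _; first by rewrite divr_ge0 // ltW.
  by rewrite le_eqVlt; apply/orP; left; apply/eqP; field; rewrite gt_eqF.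
pose d := n%:R * p.
have pE : d / n%:R = p by rewrite /d mulrC mulKf // gt_eqF.
have p01 : 0 < d / n%:R < 1 by rewrite pE p0 /=; have := p4; lra.
have XU i j : X i j = p + deviation d X i j by rewrite [LHS](deviation_add d) pE.
pose U := deviation d X.
have UE i j : U i j = X i j - p by rewrite /U /deviation pE.
pose B := same_clique R cls.
pose W i j : R := X i j - p - B i j.
have Bv i j : B i j = 0 \/ B i j = 1.
  rewrite /B same_cliqueE; case: (cls i) => [k|]; last by left.
  by case: (_ == _); [right|left].
have B2 i j : B i j ^+ 2 = B i j.
  by case: (Bv i j) => ->; rewrite ?expr0n ?expr1n.
have BD i j : `|B i j| ^+ D = B i j.
  case: (Bv i j) => ->; rewrite ?normr0 ?normr1 ?expr1n // expr0n.
  by case: (D) D2 => //.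
have X01 i j : 0 <= X i j <= 1 by case: XX => -[].
have brac0 : 0 <= (4 * kap + 1) / Y + C2 * p.
  apply: addr_ge0; last by apply: mulr_ge0; exact: ltW.
  by apply: divr_ge0; [lra|exact: ltW].
have aW : avg2 (fun i j => W i j ^+ 2) <= ((4 * kap + 1) / Y + C2 * p) * p ^+ D.
  have n2 : (0 : R) < n%:R ^+ 2 by rewrite exprn_gt0.
  rewrite -(ler_pM2l n2).
  have pert := planted_perturbation n8 p0 p4 T2; rewrite -/T -/X -/B in pert.
  apply: (le_trans pert).
  have -> : n%:R ^+ 2 * (((4 * kap + 1) / Y + C2 * p) * p ^+ D) =
     4 * kap * (A ^+ 2 / Y) + A ^+ 2 / Y + C2 * A ^+ 2 * p by rewrite A2; ring.
  apply: lerD offs; apply: lerD.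
    rewrite -mulrA ler_pM2l //; apply: le_trans TA _; rewrite ler_pM2l //.
    by rewrite ler_pdivlMr // expr2 ler_pM2l.
  by rewrite AY mulfK ?gt_eqF // ler_piMr ?(ltW n0R) // exprn_ile1 // ltW.
have aB : avg2 (fun i j => B i j) <= kap ^+ 2 * p ^+ D.
  have n2 : (0 : R) < n%:R ^+ 2 by rewrite exprn_gt0.
  rewrite -(ler_pM2l n2).
  have -> : n%:R ^+ 2 * avg2 (fun i j => B i j) = \sum_k (clique_size R cls k) ^+ 2.
    rewrite -sum_same_clique /avg2 /avgT !card_ord -mulr_sumr; field.
    by rewrite gt_eqF.
  apply: (@le_trans _ _ ((kap * A) ^+ 2)); last by rewrite exprMn A2 mulrCA.
  apply: (@le_trans _ _ (T ^+ 2)); last first.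
    by apply: lerXn2r; rewrite ?nnegrE //; apply: le_trans TA.
  have s0 k : 0 <= clique_size R cls k by rewrite clsE.
  have S0 : 0 <= ncovered R cls by apply: sumr_ge0.
  apply: (@le_trans _ _ (ncovered R cls * ncovered R cls)).
    rewrite {1}/ncovered mulr_suml; apply: ler_sum => k _.
    by rewrite expr2 ler_wpM2l // /ncovered (bigD1 k) //= lerDl sumr_ge0.
  by rewrite -expr2 ler_sqr ?nnegrE // /T lerDl.
have aU : avg2 (fun i j => U i j ^+ 2) <= (2 * kap ^+ 2 + 2) * p ^+ D.
  apply: (@le_trans _ _ (2 * avg2 (fun i j => B i j) +
                         2 * avg2 (fun i j => W i j ^+ 2))).
    rewrite -!avgTZ /avg2.
    have -> : avgT (fun i => 2 * avgT (B i)) + avgT (fun i => 2 * avgT (fun j => W i j ^+ 2))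
       = avgT (fun i => avgT (fun j => 2 * B i j + 2 * W i j ^+ 2)).
      rewrite {1 3 5}/avgT -mulrDr -big_split /=; congr (_ * _); apply: eq_bigr => i _.
      by rewrite /avgT !mulr_sumr -big_split /=; apply: eq_bigr => j _; ring.
    apply: ler_avgT => i; apply: ler_avgT => j.
    have -> : U i j = B i j + W i j by rewrite UE /W; ring.
    by rewrite -{2}B2; have := sqr_ge0 (B i j - W i j); lra.
  have e2 : (4 * kap + 1) / Y + C2 * p <= 1.
    have eta' : (4 * kap + 1) / Y + C2 * p <= eta.
      by rewrite /eta ler_peMl ?exprn_ege1 ?ler1n.
    by apply: le_trans eta' _.
  have : ((4 * kap + 1) / Y + C2 * p) * p ^+ D <= 1 * p ^+ D by rewrite ler_wpM2r // ltW.
  lra.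
have aWD : avg2 (fun i j => `|W i j| ^+ D) <= eta * p ^+ D.
  apply: (@le_trans _ _ (2 ^+ D * avg2 (fun i j => W i j ^+ 2))); last first.
    by rewrite /eta -mulrA ler_wpM2l // exprn_ge0.
  rewrite /avg2 -avgTZ; apply: ler_avgT => i; rewrite -avgTZ; apply: ler_avgT => j.
  have W2 : `|W i j / 2| <= 1.
    have /andP[x0 x1] := X01 i j; have := p0; have := p4.
    by rewrite ler_norml /W; case: (Bv i j) => ->; lra.
  have e : `|W i j| = 2 * `|W i j / 2|.
    by rewrite normrM [`|2^-1|]ger0_norm ?invr_ge0 //; field.
  rewrite e exprMn ler_wpM2l ?exprn_ge0 //.
  apply: le_trans (expr_le_sqr D2 W2) _.
  by rewrite exprMn ler_piMr ?sqr_ge0 // exprn_ile1 ?invr_ge0 // invf_le1 ?ler1n.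
have eta0 : 0 <= eta by rewrite /eta mulr_ge0 ?exprn_ge0.
have stab := @tdens_stable R H n n0 B W D p eta (kap ^+ 2) (leq_trans (isT : 0 < 2)%N D2)
  (fun x => eq_leq (degD x)) p0 _ _ _ aWD.
have {}stab : `|tdens (edges H) (fun=> U) - tdens (edges H) (fun=> B)| <=
    2 ^+ ne H * ((kap ^+ 2) ^+ ne H * eta `^ D%:R^-1 * p ^+ ne H).
  have UBW : tdens (edges H) (fun=> U) = tdens (edges H) (fun=> fun i j => B i j + W i j).
    apply: avg_eq => phi; apply: eq_bigr => e _.
    by rewrite UE /W; ring.
  rewrite UBW; apply: stab.
  - by rewrite eta0 eta1.
  - exact: exprn_ege1.
  - rewrite (_ : (fun i j => `|B i j| ^+ D) = (fun i j => B i j)) //.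
    by apply/funext => i; apply/funext => j; exact: BD.
have r01 : 0 <= 2 * p <= 1 by have := p0; have := p4; lra.
have K1 : 1 <= 2 * kap ^+ 2 + 2 by have := sqr_ge0 kap; lra.
have row i : avgT (fun j => U i j ^+ 2) <= 2 * p.
  by have := deviation_row_sqr n0 p01 XX i; rewrite pE.
have := homdens_approx n0 H_conn E0 (fun x => eq_leq (degD x)) D2 p0 r01 K1 XU
  (deviation_sym XX) (deviation_rowsum n0 XX) (deviation_le1 p01 XX) row aU.
have -> : gregular H D by apply/forallP => x; rewrite degD.
move=> approx.
have pe0 : 0 < p ^+ ne H by rewrite exprn_gt0.
have dens : \sum_k al k ^+ nv H - M%:R * ((nv H)%:R * kap ^+ nv H / Y) <=
    p ^- ne H * tdens (edges H) (fun=> B).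
  apply: le_trans (ler_wpM2l _ (tdens_same_clique R cls H_conn n0)); last first.
    by rewrite invr_ge0 ltW.
  have -> : M%:R * ((nv H)%:R * kap ^+ nv H / Y) =
      \sum_(k < M) ((nv H)%:R * kap ^+ nv H / Y) by rewrite sumr_const card_ord mulr_natl.
  rewrite -sumrB mulr_sumr; apply: ler_sum => k _.
  have -> : p ^- ne H * (clique_size R cls k / n%:R) ^+ nv H = ((t k)%:R / A) ^+ nv H.
    rewrite clsE pow_ne_q !expr_div_n exprMn; field.
    by rewrite !expf_neq0 ?gt_eqF.
  have := @exprB_le R (nv H) (al k) ((t k)%:R / A) kap Y^-1.
  rewrite divr_ge0 ?(ltW A0) //= al0 => /(_ isT isT).
  have ak : al k <= kap.
    by rewrite /kap (bigD1 k) //= -addrA lerDl addr_ge0 // sumr_ge0.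
  have aty : al k - (t k)%:R / A <= Y^-1.
    apply: (@le_trans _ _ A^-1); last by rewrite lef_pV2 ?posrE.
    by rewrite lerBlDr -[X in X + _]mul1r -mulrDl ler_pdivlMr // addrC At.
  move=> /(_ ak kap1 aty); rewrite invr_ge0 (ltW Y0) => /(_ isT); lra.
move: approx; rewrite ler_norml => /andP[approx _].
move: stab; rewrite ler_norml => /andP[stab _].
have stab2 : p ^- ne H * tdens (edges H) (fun=> B) -
    2 ^+ ne H * (kap ^+ 2) ^+ ne H * eta `^ D%:R^-1 <=
    p ^- ne H * tdens (edges H) (fun=> U).
  rewrite -(ler_pM2l pe0) mulrBr !mulVKf ?gt_eqF //.
  move: stab; lra.
lra.
Qed.

End UpperBound.

(** * Letting n tend to infinity *)

Section GraphFacts.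
Variable H : sgraph.
Hypothesis H_conn : gconnected H.
Hypothesis H_maxdeg : (2 <= maxdeg H)%N.
Local Notation V := 'I_(nv H).

Lemma deg_le_maxdeg (x : V) : (deg x <= maxdeg H)%N.
Proof. exact: (leq_bigmax x). Qed.

Lemma maxdeg_attained : exists x : V, deg x = maxdeg H.
Proof.
have v0 : (0 < #|V|)%N by rewrite card_ord; case: H_conn.
by have [x xE] := @bigop.eq_bigmax V (@deg H) v0; exists x.
Qed.

Lemma maxdeg_nv : (2 <= nv H)%N.
Proof.
have [x xE] := maxdeg_attained; apply: leq_trans H_maxdeg _.
by rewrite -xE degE; apply: leq_trans (max_card _) _; rewrite card_ord.
Qed.

Lemma has_edge : (0 < ne H)%N.
Proof.
have [x xE] := maxdeg_attained.
have : (0 < deg x)%N by rewrite xE; apply: leq_trans H_maxdeg.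
rewrite degE card_gt0 => /finset.set0Pn[y]; rewrite inE => /edge_exists[e [eE _ _]].
by apply/card_gt0P; exists e.
Qed.

Lemma deg_gt0 (x : V) : (0 < deg x)%N.
Proof.
rewrite lt0n; apply/eqP => dx0.
have nadj y : adj x y = false.
  apply/negbTE/negP => axy; move/eqP: dx0; rewrite degE cards_eq0 => /eqP s0.
  by have : y \in [set y | adj x y] by [rewrite inE]; rewrite s0 inE.
have all y : y == x.
  apply: (@connected_ind _ H_conn (fun y => y == x) x) => // y' z + /eqP yx.
  by rewrite yx nadj.
have : (#|V| <= 1)%N.
  rewrite -[X in (_ <= X)%N](cards1 x); apply: subset_leq_card.
  by apply/fintype.subsetP => y _; rewrite inE all.
by rewrite card_ord leqNgt maxdeg_nv.
Qed.

Lemma maxdeg2_regular : (forall x : V, deg x <> 1%N) -> maxdeg H = 2%N ->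
  gregular H 2.
Proof.
move=> deg1 m2; apply/forallP => x.
have := deg_le_maxdeg x; have := deg_gt0 x; have := deg1 x; rewrite m2.
by case: (deg x) => [|[|[|]]].
Qed.

End GraphFacts.

Local Open Scope classical_set_scope.

Section Asymptotics.
Variables (R : realType) (H : sgraph) (d : nat -> R).
Local Notation D := (maxdeg H).
Local Notation p n := (d n / n%:R).
Hypothesis H_conn : gconnected H.
Hypothesis H_maxdeg : (2 <= D)%N.
Hypothesis p_01 : \forall n \near \oo, 0 < d n / n%:R < 1.
Hypothesis p_lower : much_less (fun n => n%:R `^ (- D%:R^-1))
                       (fun n => d n / n%:R).
Hypothesis p_to0 : d n / n%:R @[n --> \oo] --> (0 : R).

Let D0 : (0 < D)%N. Proof. exact: leq_trans H_maxdeg. Qed.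

Lemma near_n_ge (N : nat) : \forall n \near \oo, (N <= n)%N.
Proof. exact: nbhs_infty_ge. Qed.

Lemma near_p_le (c : R) : 0 < c -> \forall n \near \oo, p n <= c.
Proof.
move=> c0; have /cvgr0Pnorm_le/(_ _ c0) := p_to0.
by apply: filterS => n; apply: le_trans; exact: ler_norm.
Qed.

Lemma near_log_ge (L0 : R) : \forall n \near \oo, L0 <= ln (p n)^-1.
Proof.
have := near_p_le (expR_gt0 (- L0)); apply: filterS2 p_01 => n /andP[p0 p1] pL.
by rewrite -[leLHS]expRK ler_ln ?posrE ?expR_gt0 ?invr_gt0 // -[expR L0]invrK
  -expRN lef_pV2 ?posrE ?expR_gt0.
Qed.

(** This is the D-th power of the assumption n^(-1/D) << p. *)
Lemma near_npD_ge (A : R) : \forall n \near \oo, A <= n%:R * p n ^+ D.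
Proof.
wlog A1 : A / 1 <= A.
  move=> h; have := h (Num.max A 1); rewrite le_max lexx orbT => /(_ isT).
  by apply: filterS => n; rewrite ge_max => /andP[].
have A0 : 0 < A by apply: lt_le_trans A1.
have Ai0 : 0 < A^-1 by rewrite invr_gt0.
have /cvgr0Pnorm_le/(_ _ Ai0) := p_lower.
apply: filterS3 p_01 (near_n_ge 1) => n /andP[p0 p1] n1 h.
have n0 : (0 : R) < n%:R by rewrite ltr0n.
have {h} : (n%:R `^ (- D%:R^-1) / p n) ^+ D <= A^-1 ^+ D.
  have b0 : 0 <= n%:R `^ (- D%:R^-1) / p n.
    by apply: divr_ge0; [exact: powR_ge0|exact: ltW].
  apply: lerXn2r; rewrite ?nnegrE ?b0 ?(ltW Ai0) //.
  exact: le_trans (ler_norm _) h.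
rewrite expr_div_n -(powR_mulrn _ (powR_ge0 _ _)) -powRrM mulNr mulVf; last first.
  by rewrite pnatr_eq0 -lt0n.
rewrite powR_inv1 ?(ltW n0) // => h.
have {}h : n%:R^-1 / p n ^+ D <= A^-1.
  apply: le_trans h _; rewrite -[leRHS]expr1; apply: ler_wiXn2l => //.
    exact: ltW.
  by rewrite invf_le1.
by rewrite -lef_pV2 ?posrE ?mulr_gt0 ?exprn_gt0 // invfM.
Qed.

Lemma Ient_ge0 (q x : R) : 0 < q < 1 -> 0 <= x <= 1 -> 0 <= Ient q x.
Proof.
move=> q01 x01; apply: le_trans (Ient_ge_poisson q01 x01).
case/andP: x01 => + _; rewrite le_eqVlt => /orP[/eqP <-|x0].
  by rewrite mul0r add0r subr0; case/andP: q01 => /ltW.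
have q0 : 0 < q by case/andP: q01.
have := ln_ge_1subV (divr_gt0 x0 q0); rewrite invf_div -(ler_pM2l x0).
by rewrite mulrBr mulrCA mulfV ?gt_eqF //; lra.
Qed.

Lemma root_le (z c : R) : 0 <= z -> 0 <= c -> z <= c ^+ D -> z `^ D%:R^-1 <= c.
Proof.
move=> z0 c0 zc; rewrite -[leRHS](root_exprK D0 c0).
by apply: ge0_ler_powR; rewrite ?nnegrE ?exprn_ge0 ?invr_ge0.
Qed.

Lemma near_lower (delta eta C : R) :
  0 < eta -> eta <= 2^-1 -> eta < delta -> 0 <= C ->
  \forall n \near \oo, forall X : 'M[R]_n, Xdset (d n) X ->
    1 + delta <= homdens (p n) H X -> Imx (p n) X <= C * anp n (p n) H ->
    gregular H D /\ cost H D (delta - eta) <= C / (1 - eta) + eta.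
Proof.
move=> eta0 eta2 etad C0.
have eta01 : 0 < eta < 1 by rewrite eta0 /=; lra.
have [L0 L00 ent] := Ient_ge_sqr eta01.
pose K : R := 2 ^+ ne H * (2 * C + 1) ^+ ne H.
have K0 : 0 < K by rewrite mulr_gt0 ?exprn_gt0 //; lra.
have c0 : 0 < (eta / K) ^+ D / 2 by rewrite divr_gt0 // exprn_gt0 // divr_gt0.
have half0 : (0 : R) < 2^-1 by rewrite invr_gt0.
near=> n => X Xd hom Ile.
have p01 : 0 < p n < 1 by near: n.
have n0 : (0 < n)%N by near: n; exact: near_n_ge.
have L : L0 <= ln (p n)^-1 by near: n; exact: near_log_ge.
apply: (lower_bound_det n0 H_conn p01 Xd H_maxdeg (has_edge H_conn H_maxdeg)
  (@deg_le_maxdeg H) eta0 eta2 etad C0 _ _ _ _ _ hom Ile erefl).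
- by near: n; exact: near_p_le.
- exact: lt_le_trans L.
- rewrite -ler_pdivrMl // mulr1; near: n; exact: near_npD_ge.
- by move=> x; exact: ent.
- have /andP[p0 _] := p01; rewrite -/K -ler_pdivlMl //.
  apply: root_le; first by apply: mulr_ge0 => //; exact: ltW.
    by rewrite mulr_ge0 ?invr_ge0 ?(ltW K0) ?(ltW eta0).
  rewrite mulrC [K^-1 * eta]mulrC -ler_pdivlMr //; near: n; exact: near_p_le.
Unshelve. all: by end_near. Qed.

Lemma small_eta (delta eps C al : R) : 0 < delta -> 0 < eps -> 0 < al -> 0 <= C ->
  exists eta : R, [/\ 0 < eta, eta <= 2^-1, eta < delta &
    eta `^ al + eta * (1 + 2 * C) < eps].
Proof.
move=> d0 e0 al0 C0; pose z := (eps / 2) `^ al^-1.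
have z0 : 0 < z by rewrite powR_gt0 // divr_gt0.
have k0 : 0 < eps / (4 * (1 + 2 * C)) by rewrite divr_gt0 //; lra.
pose eta := Num.min (Num.min 2^-1 (delta / 2)) (Num.min z (eps / (4 * (1 + 2 * C)))).
have eta0 : 0 < eta by rewrite !lt_min z0 k0 invr_gt0 divr_gt0 // ltr0n.
have [h1 h2 h3 h4] : [/\ eta <= 2^-1, eta <= delta / 2, eta <= z &
    eta <= eps / (4 * (1 + 2 * C))].
  by split; rewrite !ge_min lexx ?orbT.
exists eta; split=> //; first lra.
have h5 : eta `^ al <= eps / 2.
  apply: (@le_trans _ _ (z `^ al)).
    by apply: ge0_ler_powR; rewrite ?nnegrE ?(ltW al0) ?(ltW eta0) ?(ltW z0).
  by rewrite /z -powRrM mulVf ?gt_eqF // powRr1 //; lra.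
have h6 : eta * (1 + 2 * C) <= eps / 4.
  have c0 : 0 < 1 + 2 * C by lra.
  apply: (@le_trans _ _ (eps / (4 * (1 + 2 * C)) * (1 + 2 * C))).
    by rewrite ler_wpM2r // ltW.
  by rewrite le_eqVlt; apply/orP; left; apply/eqP; field; rewrite gt_eqF.
lra.
Qed.

Let al : R := 2 / (nv H)%:R.

Let al0 : 0 < al.
Proof. by rewrite divr_gt0 // ltr0n; case: H_conn. Qed.

Lemma anp_gt0 (n : nat) (q : R) : (0 < n)%N -> 0 < q < 1 -> 0 < anp n q H.
Proof.
move=> n0 /andP[q0 q1]; rewrite /anp !mulr_gt0 ?exprn_gt0 ?ltr0n //.
by rewrite ln_gt0 // invf_gt1.
Qed.

(** Letting eta tend to 0 in near_lower; cost is continuous by subadditivity. *)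
Lemma lower_regular (delta eps : R) : 0 < delta -> 0 < eps ->
  \forall n \near \oo, forall X : 'M[R]_n, Xdset (d n) X ->
    1 + delta <= homdens (p n) H X ->
    (cost H D delta - eps) * anp n (p n) H <= Imx (p n) X.
Proof.
move=> delta0 eps0.
have [C0|C0] := leP 0 (cost H D delta - eps); last first.
  near=> n => X Xd _.
  have p01 : 0 < p n < 1 by near: n.
  have n0 : (0 < n)%N by near: n; exact: near_n_ge.
  apply: (@le_trans _ _ 0).
    by rewrite mulr_le0_ge0 // ltW // anp_gt0.
  apply: sumr_ge0 => i _; apply: sumr_ge0 => j _; apply: Ient_ge0 => //.
  by case: Xd => -[].
have [eta [eta0 eta2 etad etae]] := small_eta delta0 eps0 al0 C0.
have := near_lower eta0 eta2 etad C0; apply: filterS => n low X Xd hom.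
rewrite leNgt; apply/negP => /ltW Ile.
have [_ bad] := low X Xd hom Ile.
have := @cost_subadd R H D (delta - eta) eta (maxdeg_nv H_conn H_maxdeg).
rewrite subrK subr_ge0 (ltW etad) (ltW eta0) /= => /(_ isT).
have e1 : eta <= 1 by lra.
rewrite e1 => /(_ isT) sub.
have h : (cost H D delta - eps) / (1 - eta) <=
    (cost H D delta - eps) + 2 * (cost H D delta - eps) * eta.
  rewrite ler_pdivrMr; last by lra.
  have : 0 <= (cost H D delta - eps) * eta * (1 - 2 * eta).
    by rewrite !mulr_ge0 ?(ltW eta0) //; lra.
  lra.
lra.
Unshelve. all: by end_near. Qed.

Lemma lower_irregular (delta C : R) : 0 < delta -> ~~ gregular H D ->
  0 <= C ->
  \forall n \near \oo, forall X : 'M[R]_n, Xdset (d n) X ->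
    1 + delta <= homdens (p n) H X -> C * anp n (p n) H <= Imx (p n) X.
Proof.
move=> delta0 /negP nreg C0.
have [eta [eta0 eta2 etad _]] := small_eta delta0 ltr01 ltr01 C0.
have := near_lower eta0 eta2 etad C0; apply: filterS => n low X Xd hom.
rewrite leNgt; apply/negP => /ltW Ile.
by have [/nreg] := low X Xd hom Ile.
Qed.

(** Plant cliques for the slightly larger excess delta + e1, so that the error
    terms of upper_bound_det are absorbed by e1. *)
Lemma upper_regular (delta eps : R) : 0 < delta -> 0 < eps -> gregular H D ->
  \forall n \near \oo, exists X : 'M[R]_n, [/\ Xdset (d n) X,
    1 + delta <= homdens (p n) H X &
    Imx (p n) X <= (cost H D delta + eps) * anp n (p n) H].
Proof.
move=> delta0 eps0 /forallP reg.
have degD (x : 'I_(nv H)) : deg x = D by apply/eqP.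
have half : 0 < eps / 2 by rewrite divr_gt0.
have [e1 [e10 e12 _ e1e]] := small_eta delta0 half al0 (lexx 0).
have e11 : e1 <= 1 by lra.
have s0 : 0 <= delta + e1 by lra.
have [M [a [a0 av a2 aD]]] := exists_clique_scales D (maxdeg_nv H_conn H_maxdeg) s0.
pose kap : R := \sum_k a k + 1.
pose C2 : R := kap ^+ 2 + 8 * kap ^+ 3 + 8 + 32 * kap ^+ 4.
have kap1 : 1 <= kap by rewrite lerDr; apply: sumr_ge0.
have kap0 : 0 < kap by apply: lt_le_trans kap1.
have C20 : 0 < C2.
  have := exprn_gt0 2 kap0; have := exprn_gt0 3 kap0; have := exprn_gt0 4 kap0.
  by rewrite /C2; lra.
pose E1 : R := M%:R * ((nv H)%:R * kap ^+ nv H).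
pose E2 : R := 2 ^+ ne H * (kap ^+ 2) ^+ ne H.
pose E3 : R := 2 ^+ ne H * (2 * kap ^+ 2 + 2) ^+ ne H.
have E20 : 0 < E2 by rewrite mulr_gt0 ?exprn_gt0.
have E30 : 0 < E3.
  by rewrite mulr_gt0 ?exprn_gt0 // ltr_wpDl // mulr_ge0 // exprn_ge0 // ltW.
pose eta2 : R := Num.min 1 ((e1 / 3 / E2) ^+ D).
have eta20 : 0 < eta2 by rewrite lt_min ltr01 exprn_gt0 // !divr_gt0.
pose h2 : R := eta2 / 2 ^+ D / 2.
have h20 : 0 < h2 by rewrite !divr_gt0 // exprn_gt0.
have c1 : 0 < (16 * kap ^+ 2)^-1 by rewrite invr_gt0 mulr_gt0 // exprn_gt0.
have c2 : 0 < h2 / C2 by rewrite divr_gt0.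
have c3 : 0 < (e1 / 3 / E3) ^+ D / 2 by rewrite divr_gt0 // exprn_gt0 // !divr_gt0.
have c4 : (0 : R) < 4^-1 by rewrite invr_gt0.
near=> n.
have p01 : 0 < p n < 1 by near: n.
have n8 : (8 <= n)%N by near: n; exact: near_n_ge.
have /andP[p0 p1] := p01.
have n0 : (0 < n)%N by apply: leq_trans n8.
have n0R : (0 : R) < n%:R by rewrite ltr0n.
have p4 : p n <= 4^-1 by near: n; exact: near_p_le.
have kapp : 16 * kap ^+ 2 * p n <= 1.
  rewrite -ler_pdivlMl ?mulr_gt0 ?exprn_gt0 // mulr1.
  by near: n; exact: near_p_le.
have Y1 : 1 <= n%:R * p n ^+ D by near: n; exact: near_npD_ge.
have Y0 : 0 < n%:R * p n ^+ D by apply: lt_le_trans Y1.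
have Y2 : (4 * kap + 1) / h2 <= n%:R * p n ^+ D by near: n; exact: near_npD_ge.
have Y3 : E1 / (e1 / 3) <= n%:R * p n ^+ D by near: n; exact: near_npD_ge.
have pC : p n <= h2 / C2 by near: n; exact: near_p_le.
have pE3 : p n <= (e1 / 3 / E3) ^+ D / 2 by near: n; exact: near_p_le.
have Ln : 4 * C2 / eps <= ln (p n)^-1 by near: n; exact: near_log_ge.
have etale : 2 ^+ D * ((4 * kap + 1) / (n%:R * p n ^+ D) + C2 * p n) <= eta2.
  rewrite -ler_pdivlMl ?exprn_gt0 // [leRHS]mulrC.
  have -> : eta2 / 2 ^+ D = h2 + h2 by rewrite /h2 -splitr.
  apply: lerD; last by rewrite -ler_pdivlMl // [leRHS]mulrC.
  by rewrite ler_pdivrMr // [leRHS]mulrC -ler_pdivrMr.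
have alq k : a k * Num.sqrt (p n ^+ D) <= p n.
  have sq : Num.sqrt (p n ^+ D) ^+ 2 = p n ^+ D by rewrite sqr_sqrtr // exprn_ge0 // ltW.
  have ak0 : 0 <= a k * Num.sqrt (p n ^+ D) by rewrite mulr_ge0 ?sqrtr_ge0.
  rewrite -ler_sqr ?nnegrE ?ak0 ?(ltW p0) // exprMn sq.
  have [De|Dn] := eqVneq D 2%N.
    rewrite De -[leRHS]mul1r ler_wpM2r ?sqr_ge0 //.
    by rewrite exprn_ile1 // aD.
  have D3 : (3 <= D)%N by rewrite ltn_neqAle eq_sym Dn.
  apply: (@le_trans _ _ (kap ^+ 2 * p n ^+ 3)).
    apply: ler_pM; rewrite ?sqr_ge0 ?exprn_ge0 ?(ltW p0) //.
      rewrite ler_sqr ?nnegrE ?(ltW kap0) //.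
      by rewrite /kap (bigD1 k) //= -addrA lerDl addr_ge0 // sumr_ge0.
    by apply: ler_wiXn2l => //; exact: ltW.
  rewrite (exprS (p n) 2) mulrA -[leRHS]mul1r ler_wpM2r ?sqr_ge0 //.
  have : 0 <= kap ^+ 2 * p n by apply: mulr_ge0; [exact: sqr_ge0|exact: ltW].
  lra.
have eta1 : 2 ^+ D * ((4 * kap + 1) / (n%:R * p n ^+ D) + C2 * p n) <= 1.
  by apply: le_trans etale _; rewrite ge_min lexx.
have [X []] := upper_bound_det n8 H_conn H_maxdeg (has_edge H_conn H_maxdeg) degD
  p0 p4 a0 alq kapp Y1 eta1.
have -> : n%:R * p n = d n by rewrite mulrC divfK // gt_eqF.
move=> Xd IX hX; exists X; split=> //.
  have err1 : M%:R * ((nv H)%:R * kap ^+ nv H / (n%:R * p n ^+ D)) <= e1 / 3.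
    rewrite mulrA -/E1 ler_pdivrMr // [leRHS]mulrC -ler_pdivrMr //.
    by rewrite divr_gt0.
  have err2 : E2 * (2 ^+ D * ((4 * kap + 1) / (n%:R * p n ^+ D) + C2 * p n)) `^ D%:R^-1
      <= e1 / 3.
    rewrite -ler_pdivlMl // [leRHS]mulrC; apply: root_le.
    - rewrite mulr_ge0 ?exprn_ge0 // addr_ge0 //.
        by rewrite divr_ge0 ?(ltW Y0) //; lra.
      by apply: mulr_ge0; exact: ltW.
    - by rewrite !divr_ge0 ?(ltW e10) ?(ltW E20).
    - by apply: le_trans etale _; rewrite ge_min lexx orbT.
  have err3 : E3 * (2 * p n) `^ D%:R^-1 <= e1 / 3.
    rewrite -ler_pdivlMl // [leRHS]mulrC; apply: root_le.
    - by apply: mulr_ge0 => //; exact: ltW.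
    - by rewrite !divr_ge0 ?(ltW e10) ?(ltW E30).
    - by rewrite [leLHS]mulrC -ler_pdivlMr.
  apply: le_trans hX; rewrite av -/kap -/C2 -/E2 -/E3; lra.
apply: le_trans IX _; rewrite -/kap -/C2 a2 /anp.
have L0 : 0 < ln (p n)^-1 by rewrite ln_gt0 // invf_gt1.
have nn : 0 < n%:R ^+ 2 * p n ^+ D by rewrite mulr_gt0 ?exprn_gt0.
have -> : (cost H D delta + eps) * (n%:R ^+ 2 * p n ^+ D * ln (p n)^-1) =
  (cost H D delta + eps) * ln (p n)^-1 * (n%:R ^+ 2 * p n ^+ D) by ring.
rewrite ler_pM2r //.
have e101 : 0 <= e1 <= 1 by rewrite (ltW e10).
have sub := @cost_subadd R H D delta e1 (maxdeg_nv H_conn H_maxdeg) (ltW delta0) e101.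
have cl : cost H D (delta + e1) <= cost H D delta + eps / 2.
  apply: le_trans sub _; rewrite lerD2l; move: e1e; rewrite mulr0 addr0 mulr1 /al; lra.
have C2L : 2 * C2 <= eps / 2 * ln (p n)^-1.
  by move: Ln; rewrite ler_pdivrMr //; lra.
have := ler_wpM2r (ltW L0) cl; lra.
Unshelve. all: by end_near. Qed.

End Asymptotics.

Section Phi.
Variables (R : realType) (H : sgraph) (n : nat) (d t b : R).
Hypothesis anp0 : 0 < anp n (d / n%:R) H.

Lemma phi_ge :
  (forall X : 'M[R]_n, Xdset d X -> t <= homdens (d / n%:R) H X ->
     b * anp n (d / n%:R) H <= Imx (d / n%:R) X) ->
  ((b / 2)%:E <= phi n d H t)%E.
Proof.
move=> low; rewrite /phi /Phi.
have -> : (b / 2)%:E = ((anp n (d / n%:R) H)^-1%:E *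
    ((2^-1)%:E * (b * anp n (d / n%:R) H)%:E))%E.
  by rewrite -!EFinM; congr (_%:E); field; rewrite gt_eqF.
apply: lee_wpmul2l; first by rewrite lee_fin invr_ge0 ltW.
apply: lee_wpmul2l; first by rewrite lee_fin.
by apply: le_ereal_inf_tmp => _ [X [Xd hX] <-]; rewrite lee_fin; exact: low.
Qed.

Lemma phi_le (X : 'M[R]_n) : Xdset d X -> t <= homdens (d / n%:R) H X ->
  Imx (d / n%:R) X <= b * anp n (d / n%:R) H ->
  (phi n d H t <= (b / 2)%:E)%E.
Proof.
move=> Xd hX IX; rewrite /phi /Phi.
have -> : (b / 2)%:E = ((anp n (d / n%:R) H)^-1%:E *
    ((2^-1)%:E * (b * anp n (d / n%:R) H)%:E))%E.
  by rewrite -!EFinM; congr (_%:E); field; rewrite gt_eqF.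
apply: lee_wpmul2l; first by rewrite lee_fin invr_ge0 ltW.
apply: lee_wpmul2l; first by rewrite lee_fin.
apply: (@le_trans _ _ (Imx (d / n%:R) X)%:E); last by rewrite lee_fin.
by apply: ereal_inf_lbound; exists X.
Qed.

End Phi.

Lemma cvg_EFin_sandwich (R : realType) (f : nat -> \bar R) (c : R) :
  (forall eps : R, 0 < eps -> \forall n \near \oo,
     ((c - eps)%:E <= f n /\ f n <= (c + eps)%:E)%E) ->
  f n @[n --> \oo] --> c%:E.
Proof.
move=> h; apply/fine_cvgP; split.
  have := h 1 ltr01; apply: filterS => n [h1 h2].
  by rewrite fin_numElt (lt_le_trans (ltNyr _) h1) (le_lt_trans h2 (ltry _)).
apply/cvgrPdist_le => eps eps0; have := h eps eps0; apply: filterS => n [h1 h2] /=.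
have fn : f n \is a fin_num.
  by rewrite fin_numElt (lt_le_trans (ltNyr _) h1) (le_lt_trans h2 (ltry _)).
rewrite -(fineK fn) !lee_fin in h1 h2.
by rewrite ler_distl; apply/andP; split; lra.
Qed.

Theorem theorem1p1 (R : realType) (delta : R) (H : sgraph) (d : nat -> R)
  (delta_gt0 : 0 < delta)
  (H_conn : gconnected H)
  (H_deg1 : forall x : 'I_(nv H), deg x <> 1%N)
  (H_maxdeg : (2 <= maxdeg H)%N)
  (p_01 : \forall n \near \oo, 0 < d n / n%:R < 1)
  (p_lower : much_less (fun n => n%:R `^ (- (maxdeg H)%:R^-1))
                       (fun n => d n / n%:R))
  (p_to0 : d n / n%:R @[n --> \oo] --> (0 : R)) :
  phi n (d n) H (1 + delta) @[n --> \oo] --> cd H delta.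
Proof.
have anp0 : \forall n \near \oo, 0 < anp n (d n / n%:R) H.
  by apply: filterS2 p_01 (near_n_ge 1) => n p01 n0; apply: anp_gt0.
have [reg|nreg] := boolP (gregular H (maxdeg H)).
  have -> : cd H delta = (cost H (maxdeg H) delta / 2)%:E.
    rewrite /cd /cost /stair reg; case: eqP => [_|/eqP D2] /=.
      by rewrite -EFinM [in LHS]mulrC.
    by rewrite ltn_neqAle eq_sym D2 H_maxdeg -EFinM [in LHS]mulrC.
  apply: cvg_EFin_sandwich => eps eps0.
  have eps20 : 0 < eps * 2 by rewrite mulr_gt0.
  have low := lower_regular H_conn H_maxdeg p_01 p_lower p_to0 delta_gt0 eps20.
  have up := upper_regular H_conn H_maxdeg p_01 p_lower p_to0 delta_gt0 eps20 reg.
  apply: filterS3 anp0 low up => n a0 lown [X [Xd hX IX]]; split.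
    have -> : cost H (maxdeg H) delta / 2 - eps =
              (cost H (maxdeg H) delta - eps * 2) / 2 by field.
    exact: phi_ge.
  have -> : cost H (maxdeg H) delta / 2 + eps =
            (cost H (maxdeg H) delta + eps * 2) / 2 by field.
  exact: (phi_le a0 Xd hX IX).
have D2 : (maxdeg H == 2%N) = false.
  apply: contraNF nreg => /eqP D2; rewrite D2.
  exact: maxdeg2_regular.
have -> : cd H delta = +oo%E.
  by rewrite /cd D2 (negPf nreg) /= gt0_muley // lte_fin.
apply/cvgeyPge => A.
have C0 : 0 <= `|A| * 2 by rewrite mulr_ge0.
have low := lower_irregular H_conn H_maxdeg p_01 p_lower p_to0 delta_gt0 nreg C0.
apply: filterS2 anp0 low => n a0 lown.
apply: (@le_trans _ _ ((`|A| * 2) / 2)%:E); last exact: phi_ge.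
by rewrite lee_fin mulfK ?ler_norm.
Qed.
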